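(* Let $\mathbb K$ be a field of characteristic zero, $R=\mathbb K[x_0,\ldots,x_n]$, $S=\mathbb K[y_0,\ldots,y_n]$. (Direct part.) Let $Z=\{P_1,\ldots,P_m\}\subset\mathbb P^n$ be a non-empty reduced zero-dimensional scheme consisting of $m$ distinct points, with $P_i=[a_{i,0},a_{i,1},\ldots,a_{i,n}]$, $a_{i,j}\in\mathbb K$. Let $I_Z\subset R$ be the ideal of $Z$, let $r=\mathrm{reg}(R/I_Z)$, and let $L_i=a_{i,0}y_0+a_{i,1}y_1+\cdots+a_{i,n}y_n\in S$ be the dual linear form of $P_i$. Suppose that $Z$ is arithmetically Gorenstein and that $\ell\in R$ is a linear form such that $\ell(P_i)\neq 0$ for all $i=1,\ldots,m$ (i.e., $\ell$ is a non-zero divisor in $R/I_Z$). Then there exist non-zero constants $c_1,\ldots,c_m\in\mathbb K$, unique up to simultaneous multiplication by a non-zero scalar, such that $$c_1\ell(P_1)L_1^{r-1}+\cdots+c_m\ell(P_m)L_m^{r-1}=0,$$ and for these constants $$\langle I_Z,\ell\rangle=\mathrm{Ann}(c_1L_1^r+\cdots+c_mL_m^r).$$ (Converse part.) Let $L_i=a_{i,0}y_0+\cdots+a_{i,n}y_n\in S$, $i=1,\ldots,m$, $m\geq 1$, be non-zero linear forms, let $c_1,\ldots,c_m\in\mathbb K$ be non-zero constants, and let $F=c_1L_1^r+\cdots+c_mL_m^r\in S$ be a form of degree $r$ such that 1. $\dim_{\mathbb K}\mathrm{Span}_{\mathbb K}\langle L_1^r,\ldots,L_m^r\rangle=m$,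 and 2. there exist non-zero constants $d_1,\ldots,d_m\in\mathbb K$, unique up to simultaneous multiplication by a non-zero scalar, such that $d_1L_1^{r-1}+\cdots+d_mL_m^{r-1}=0$. Let $Z=\{P_1,\ldots,P_m\}\subset\mathbb P^n$, $P_i=[a_{i,0},\ldots,a_{i,n}]$, be the set of points dual to the linear forms $L_i$, and let $I_Z\subset R$ be its ideal. Assume that $Z$ has symmetric $h$-vector. Then $Z$ is arithmetically Gorenstein and $\mathrm{reg}(R/I_Z)=r$. Furthermore, for a linear form $\tilde\ell\in R$, one has $\mathrm{Ann}(F)=\langle I_Z,\tilde\ell\rangle$ if and only if, after possibly multiplying $(d_1,\ldots,d_m)$ by a common non-zero scalar, $\tilde\ell(P_i)=\frac{d_i}{c_i}$ for all $i=1,\ldots,m$.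
   Context: $R$ and $S$ are standard graded polynomial rings. $R$ acts on $S$ by differentiation: $x_0^{i_0}\cdots x_n^{i_n}\circ G=\frac{\partial^{i_0+\cdots+i_n}G}{\partial y_0^{i_0}\cdots\partial y_n^{i_n}}$, extended $\mathbb K$-linearly. For $F\in S$, $\mathrm{Ann}(F)=\{f\in R\mid f\circ F=0\}$. For each point $P_i$ a coordinate vector $(a_{i,0},\ldots,a_{i,n})\in\mathbb K^{n+1}\setminus\{0\}$ is fixed; the same vector gives the coefficients of $L_i$, and for a linear form $\ell=\sum_j b_jx_j$ the value $\ell(P_i)$ means $\sum_j b_ja_{i,j}$. The ideal $I_Z$ is the homogeneous ideal generated by all forms in $R$ vanishing at every point of $Z$. A $d$-dimensional projective scheme $X\subset\mathbb P^n$ with defining ideal $I_X$ is arithmetically Gorenstein if the localization of $R/I_X$ at every prime ideal is a local Gorenstein ring; equivalently, the graded minimal free resolution of $R/I_X$ over $R$ has the form $0\to F_k\to\cdots\to F_1\to R\to R/I_X\to 0$ with $k=n-d$ and $F_k\simeq R(-\alpha)$ of rank one. For a finite set of points, $d=0$ and $k=n$. $\mathrm{reg}(R/I_Z)$ is the Castelnuovo-Mumford regularity of $R/I_Z$; in the arithmetically Gorenstein case it equals $\alpha-k$. The $h$-vector of a finite reduced set of points $Z$ is the vector $(h_0,\ldots,h_s)$ of values of the Hilbert function of the Artinian reduction of $R/I_Z$ by a general linear form, i.e. $h_j=\dim_{\mathbb K}(R/I_Z)_j-\dim_{\mathbb K}(R/I_Z)_{j-1}$, where $s$ is the last degree in which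 it is non-zero. It is symmetric if $h_j=h_{s-j}$ for all $0\le j\le s$. Convention: if $r=0$, the expressions $L_i^{r-1}$ are read as $0$. *)

(* Defs.v *)
From HB Require Import structures.
From mathcomp Require Import all_boot all_order all_algebra.
From mathcomp Require Export mpoly.

Set Implicit Arguments.
Unset Strict Implicit.
Unset Printing Implicit Defensive.

Import GRing.Theory.
Local Open Scope ring_scope.

(** The rings R = K[x_0, .., x_n] and S = K[y_0, .., y_n] are both modelled by
    [{mpoly K[n.+1]}]; ideals are [Prop]-valued predicates. *)

Section Ideals.
Context {K : fieldType} {n : nat}.
Local Notation R := {mpoly K[n]}.

Definition ideal_gen (G : R -> Prop) (f : R) : Prop :=
  exists (k : nat) (u g : 'I_k -> R),
    (forall i, G (g i)) /\ f = \sum_(i < k) u i * g i.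

Definition ideal_add (I : R -> Prop) (l : R) : R -> Prop :=
  ideal_gen (fun f => I f \/ f = l).

Definition diff_act (f G : R) : R := \sum_(m <- msupp f) f@_m *: G^`M[m].

Definition Ann (F : R) (f : R) : Prop := diff_act f F = 0.

End Ideals.

Section Points.
Context {K : fieldType} {n m : nat}.
Implicit Types a : 'I_m -> 'I_n -> K.

Definition nonzero_coords a : Prop := forall i, exists j, a i j != 0.

(* For non-zero coordinate vectors: the points of projective space they
   represent are pairwise distinct. *)
Definition distinct_points a : Prop :=
  forall i k, i != k -> ~ exists c : K, forall j, a i j = c * a k j.

(* The generators [f] are the forms of arbitrary degree vanishing at every
   point; [f.@[a i]] is the value of [f] at the chosen coordinate vector. *)
Definition vanishing_ideal a : {mpoly K[n]} -> Prop :=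
  ideal_gen (fun f => f \is homog mdeg /\ forall i, f.@[a i] = 0).

End Points.

Section LinearForms.
Context {K : fieldType} {n : nat}.

Definition dual_form (v : 'I_n -> K) : {mpoly K[n]} := \sum_(j < n) v j *: 'X_j.

(* [L ^ (r - 1)], read as 0 when [r = 0]. *)
Definition pow_pred (L : {mpoly K[n]}) (r : nat) : {mpoly K[n]} :=
  if r is r'.+1 then L ^+ r' else 0.

Lemma dual_form_pow_homog (v : 'I_n -> K) (r : nat) :
  dual_form v ^+ r \is r.-homog.
Proof.
rewrite -[X in X.-homog]mul1n; apply: dhomogMn.
by apply: rpred_sum => j _; apply: rpredZ; rewrite dhomogX /= mdeg1.
Qed.

(* [L ^ r] as an element of the finite-dimensional space of forms of degree
   [r]. *)
Definition dual_form_pow (v : 'I_n -> K) (r : nat) : dhomog n K r :=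
  DHomog (dual_form_pow_homog v r).

End LinearForms.

(* [c] satisfies [P], has only non-zero entries, and is, among the tuples with
   these two properties, unique up to a common non-zero scalar. *)
Definition unique_nonzero_upto_scalar {K : fieldType} {m : nat}
    (P : ('I_m -> K) -> Prop) (c : 'I_m -> K) : Prop :=
  [/\ forall i, c i != 0,
      P c &
      forall c' : 'I_m -> K, (forall i, c' i != 0) -> P c' ->
        exists2 t : K, t != 0 & forall i, c' i = t * c i].

(** Graded minimal free resolutions of R/I.  The i-th free module is
      F_i = \bigoplus_j R(- (res_shifts i)_j),   F_0 = R,
    its elements are row vectors, and [res_diff i : F_(i+1) -> F_i] acts by
    right multiplication. *)
Section Resolutions.
Context {K : fieldType} {n : nat}.
Local Notation R := {mpoly K[n]}.

Record min_graded_free_res (I : R -> Prop) := MinGradedFreeRes {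
  res_shifts : nat -> seq nat;
  res_diff : forall i, 'M[R]_(size (res_shifts i.+1), size (res_shifts i));
  res_shifts0 : res_shifts 0 = [:: 0%N];
  res_finite : exists k, forall i, (k < i)%N -> res_shifts i = [::];
  (* the differentials are homogeneous of degree 0 *)
  res_graded : forall i j l mon, mon \in msupp (res_diff i j l) ->
    (mdeg mon + nth 0 (res_shifts i) l = nth 0 (res_shifts i.+1) j)%N;
  (* their entries lie in the irrelevant maximal ideal *)
  res_minimal : forall i j l, (res_diff i j l)@_0%MM = 0;
  (* The image of F_1 -> F_0 = R is I; as [res_shifts 0] has size 1,
     [const_mx f] is the 1 x 1 matrix with entry [f]. *)
  res_exact0 : forall f : R,
    I f <-> exists w : 'rV[R]_(size (res_shifts 1)),
              const_mx f = w *m res_diff 0;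
  res_exact : forall i (v : 'rV[R]_(size (res_shifts i.+1))),
    v *m res_diff i = 0 <->
    exists w : 'rV[R]_(size (res_shifts i.+2)), v = w *m res_diff i.+1
}.

(* R/I is arithmetically Gorenstein of codimension [k]: the resolution is
   0 -> R(-alpha) -> F_(k-1) -> .. -> F_1 -> R -> R/I -> 0. *)
Definition arith_gorenstein (k : nat) (I : R -> Prop) : Prop :=
  exists (F : min_graded_free_res I) (alpha : nat),
    res_shifts F k = [:: alpha] /\
    forall i, (k < i)%N -> res_shifts F i = [::].

(* reg(R/I) = r, i.e. r = max (b_{i,j} - i) over the twists R(-b_{i,j}) of
   F_i. *)
Definition has_regularity (I : R -> Prop) (r : nat) : Prop :=
  exists F : min_graded_free_res I,
    (forall i b, b \in res_shifts F i -> (b <= r + i)%N) /\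
    (exists i, (r + i)%N \in res_shifts F i).

End Resolutions.

Section HilbertFunction.
Context {K : fieldType} {n : nat}.
Local Notation R := {mpoly K[n.+1]}.

(* [H j = dim_K (R/I)_j], where [U] below is the degree [j] part of [I]. *)
Definition is_hilbert_function (I : R -> Prop) (H : nat -> nat) : Prop :=
  forall j, exists U : {vspace dhomog n.+1 K j},
    (forall f : dhomog n.+1 K j, f \in U <-> I (val f)) /\
    (\dim U + H j = \dim {: dhomog n.+1 K j})%N.

Definition first_difference (H : nat -> nat) (j : nat) : int :=
  if j is j'.+1 then (H j)%:Z - (H j')%:Z else (H 0%N)%:Z.

(* [h] restricted to degrees 0, .., s, where s is the last degree in which it
   does not vanish, is the h-vector. *)
Definition symmetric_h_vector (I : R -> Prop) : Prop :=
  exists (H : nat -> nat) (s : nat),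
    let h := first_difference H in
    [/\ is_hilbert_function I H,
        h s != 0,
        (forall j, (s < j)%N -> h j = 0) &
        (forall j, (j <= s)%N -> h j = h (s - j)%N)].

End HilbertFunction.

(* Main.v *)
Require Import Defs.
From HB Require Import structures.
From mathcomp Require Import all_boot all_order all_algebra.
From mathcomp Require Import ring zify.
From Stdlib Require Import Classical ClassicalEpsilon.

Set Implicit Arguments.
Unset Strict Implicit.
Unset Printing Implicit Defensive.

Import GRing.Theory.
Local Open Scope ring_scope.

(** The theorem compares three incarnations of one linear functional. Write I for
    the ideal of Z, J = I + (l) for a linear form l without zeros on Z, and
    B = R/J for the Artinian reduction.

    Functionals on forms of degree r are, up to I, the sums
    f |-> \sum_i c_i f(P_i), and by apolarity ([sum_pow_eq0], [Ann_sum_pow]) this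
    functional is the action of f on F = \sum_i c_i L_i^r up to the factor r!. It
    vanishes on J in degree r exactly when
    \sum_i c_i l(P_i) L_i^(r-1) = 0 ([evalform_J]). If B is Gorenstein of socle
    degree r, the functionals on B_r form a line, which gives existence and
    uniqueness of c, and J = Ann(F) because both ideals consist of the elements all
    of whose multiples in degree r are killed by the functional
    ([Ann_of_evalform]). No c_i vanishes, by a descent on the degree of a form
    separating P_i from the other points ([functional_nonzero]).

    It remains to pass between B and resolutions of R/I. Koszul homology does this.
    Over a minimal free resolution, connecting maps identify the generators of F_i
    with the i-th Koszul homology of R/I ([linked]); the Koszul complex of a free
    module is exact by Euler's formula ([koszul_exact]). On the other side, since l
    is a non-zero-divisor, the exterior product by l identifies the n-th Koszul
    homology of R/I with the socle of B ([top_part_boundary], [socle_lift]), makes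
    the homology vanish in exterior degree above n, and bounds its degrees by those
    of B ([cycle_bound]). Hence F_n has rank one if and only if the socle of B is a
    line, and the regularity is the last degree of B
    ([gorenstein_of_resolutions]). The same degree bounds show that all syzygy
    modules are finitely generated, so that minimal resolutions exist
    ([exists_min_graded_complex]).

    For the converse, conditions 1 and 2 say that the Hilbert function of Z is m in
    degree r and m - 1 in degree r - 1, so r is the last degree of the h-vector.
    The pairing (f, g) |-> \sum_i (d_i / l(P_i)) f(P_i) g(P_i) between B_k and
    B_(r-k) is well defined by the relation among the L_i^(r-1); symmetry of the
    h-vector is the equality of dimensions that makes it perfect
    ([Vdim_duality], [pairing_nondegenerate]), and a perfect pairing makes B
    Gorenstein. *)

(** * Koszul complexes *)

(** Sign of moving e_j past the smaller factors of the exterior monomial e_S. *)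
Definition ksign N (R : comNzRingType) (j : 'I_N) (S : {set 'I_N}) : R :=
  (-1) ^+ #|[set k in S | (k < j)%N]|.

(** A chain [f] stands for the element \sum_S f S e_S of M tensored with an
    exterior algebra on e_0, .., e_(N-1); [contr j] is the interior product dual
    to e_j and [wedge j] the exterior product by e_j. *)
HB.lock Definition contr N (R : comNzRingType) (M : lmodType R) (j : 'I_N)
    (f : {ffun {set 'I_N} -> M}) : {ffun {set 'I_N} -> M} :=
  [ffun S : {set 'I_N} => if j \in S then 0 else ksign R j S *: f (j |: S)].

HB.lock Definition wedge N (R : comNzRingType) (M : lmodType R) (j : 'I_N)
    (f : {ffun {set 'I_N} -> M}) : {ffun {set 'I_N} -> M} :=
  [ffun S : {set 'I_N} => if j \in S then ksign R j S *: f (S :\ j) else 0].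

HB.lock Definition wedge_form N (R : comNzRingType) (M : lmodType R) (b : 'I_N -> R)
    (f : {ffun {set 'I_N} -> M}) : {ffun {set 'I_N} -> M} :=
  \sum_j b j *: wedge j f.

HB.lock Definition kdiff N (R : comNzRingType) (M : lmodType R) (x : 'I_N -> R)
    (f : {ffun {set 'I_N} -> M}) : {ffun {set 'I_N} -> M} :=
  \sum_j x j *: contr j f.

Section Koszul.
Context (N : nat) (R : comNzRingType) (M : lmodType R).

Local Notation chain := {ffun {set 'I_N} -> M}.
Implicit Types (f g : chain) (S : {set 'I_N}) (j k : 'I_N).

Local Notation ksign := (ksign R).
Local Notation contr := (@contr N R M).
Local Notation wedge := (@wedge N R M).
Local Notation wedge_form := (@wedge_form N R M).

Lemma ksign_sq j S : ksign j S * ksign j S = 1.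
Proof. by rewrite /ksign -expr2 sqrr_sign. Qed.

Lemma ksignU1 j k S : j \notin S ->
  ksign k (j |: S) = (if (j < k)%N then -1 else 1) * ksign k S.
Proof.
move=> jS; rewrite /ksign.
have -> : [set k0 in j |: S | (k0 < k)%N] =
  (if (j < k)%N then j |: [set k0 in S | (k0 < k)%N] else [set k0 in S | (k0 < k)%N]).
  apply/setP=> i; case: ifP => jk; rewrite !inE; case: (eqVneq i j) => //= ->.
    by rewrite jk.
  by rewrite jk andbF.
case: ifP => jk; last by rewrite mul1r.
by rewrite cardsU1 inE (negbTE jS) /= add1n exprS.
Qed.

Lemma ksignD1 j k S : j \in S ->
  ksign k S = (if (j < k)%N then -1 else 1) * ksign k (S :\ j).
Proof.
by move=> jS; rewrite -{1}(setD1K jS) ksignU1 // !inE eqxx.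
Qed.

Lemma ksign_self j S : ksign j (j |: S) = ksign j S.
Proof.
rewrite /ksign; congr (_ ^+ #|pred_of_set _|); apply/setP=> i; rewrite !inE.
by case: (eqVneq i j) => //= ->; rewrite ltnn andbF.
Qed.

Lemma contrE j f S :
  contr j f S = if j \in S then 0 else ksign j S *: f (j |: S).
Proof. by rewrite contr.unlock ffunE. Qed.

Lemma wedgeE j f S :
  wedge j f S = if j \in S then ksign j S *: f (S :\ j) else 0.
Proof. by rewrite wedge.unlock ffunE. Qed.

Lemma chain0E S : (0 : chain) S = 0. Proof. by rewrite ffunE. Qed.
Lemma chain_addE f g S : (f + g) S = f S + g S. Proof. by rewrite ffunE. Qed.
Lemma chain_oppE f S : (- f) S = - f S. Proof. by rewrite ffunE. Qed.
Lemma chain_subE f g S : (f - g) S = f S - g S. Proof. by rewrite !ffunE. Qed.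
Lemma chain_scaleE (c : R) f S : (c *: f) S = c *: f S. Proof. by rewrite ffunE. Qed.
Definition chainE :=
  (chain0E, chain_addE, chain_oppE, chain_scaleE, contrE, wedgeE).

Lemma contr_is_linear j : linear (contr j).
Proof.
move=> c f g; apply/ffunP=> S; rewrite !chainE; case: ifP => _.
  by rewrite scaler0 addr0.
by rewrite scalerDr !scalerA [ksign j S * c]mulrC.
Qed.
HB.instance Definition _ j :=
  GRing.isLinear.Build R chain chain _ (contr j) (contr_is_linear j).

Lemma wedge_is_linear j : linear (wedge j).
Proof.
move=> c f g; apply/ffunP=> S; rewrite !chainE; case: ifP => _.
  by rewrite scalerDr !scalerA [ksign j S * c]mulrC.
by rewrite scaler0 addr0.
Qed.
HB.instance Definition _ j :=
  GRing.isLinear.Build R chain chain _ (wedge j) (wedge_is_linear j).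

Lemma contr_self j f : contr j (contr j f) = 0.
Proof.
apply/ffunP=> S; rewrite !chainE; case: ifP => // jS.
by rewrite setU11 scaler0.
Qed.

(** With [contr_self], [contr_wedge_self] and [contr_wedge_anti] these are the
    canonical anticommutation relations; the square and the
    homotopies of the Koszul differential are formal consequences of them. *)
Lemma contr_anti j k f : j != k -> contr j (contr k f) = - contr k (contr j f).
Proof.
move=> jk; apply/ffunP=> S; rewrite !chainE !inE (negbTE jk) (eq_sym k) (negbTE jk) /=.
case: (boolP (j \in S)) => jS; case: (boolP (k \in S)) => kS;
  rewrite ?scaler0 ?oppr0 //.
rewrite !scalerA setUCA (ksignU1 _ jS) (ksignU1 _ kS) -scaleNr; congr (_ *: _).
by case: (ltngtP j k) (jk) => [||/val_inj ->]; rewrite ?eqxx // => _ _; ring.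
Qed.

Lemma contr_wedge_self j f : contr j (wedge j f) + wedge j (contr j f) = f.
Proof.
apply/ffunP=> S; rewrite !chainE !inE eqxx /=; case: ifP => jS.
  rewrite add0r scalerA setD1K //.
  by rewrite [X in X * _](ksignD1 _ jS) ltnn mul1r ksign_sq scale1r.
by rewrite addr0 scalerA ksign_self ksign_sq scale1r setU1K ?jS.
Qed.

Lemma contr_wedge_anti j k f :
  j != k -> contr j (wedge k f) + wedge k (contr j f) = 0.
Proof.
move=> jk; apply/ffunP=> S; rewrite !chainE !inE (negbTE jk) (eq_sym k) (negbTE jk) /=.
case: (boolP (j \in S)) => jS; case: (boolP (k \in S)) => kS;
  rewrite ?scaler0 ?addr0 //.
have -> : (j |: S) :\ k = j |: (S :\ k).
  by apply/setP=> i; rewrite !inE; case: (eqVneq i j) => // ->; rewrite jk.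
rewrite !scalerA -scalerDl (ksignU1 _ jS) (ksignD1 j kS).
rewrite [X in X *: _](_ : _ = 0) ?scale0r //.
by case: (ltngtP j k) (jk) => [||/val_inj ->]; rewrite ?eqxx // => _ _; ring.
Qed.

Lemma wedge_form_def b f : wedge_form b f = \sum_j b j *: wedge j f.
Proof. by rewrite wedge_form.unlock. Qed.

Context (x : 'I_N -> R).

Local Notation kdiff := (@kdiff N R M x).

Lemma kdiff_def f : kdiff f = \sum_j x j *: contr j f.
Proof. by rewrite kdiff.unlock. Qed.

Lemma kdiff_is_linear : linear kdiff.
Proof.
move=> c f g; rewrite !kdiff_def scaler_sumr -big_split; apply: eq_bigr => j _ /=.
by rewrite linearP scalerDr !scalerA mulrC.
Qed.
HB.instance Definition _ :=
  GRing.isLinear.Build R chain chain _ kdiff kdiff_is_linear.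

Lemma kdiff_subZ (c : R) f g : kdiff (f - c *: g) = kdiff f - c *: kdiff g.
Proof. by rewrite linearB linearZ. Qed.

Lemma wedge_form_is_linear b : linear (wedge_form b).
Proof.
move=> c f g; rewrite !wedge_form_def scaler_sumr -big_split; apply: eq_bigr => j _ /=.
by rewrite linearP scalerDr !scalerA mulrC.
Qed.
HB.instance Definition _ b :=
  GRing.isLinear.Build R chain chain _ (wedge_form b) (wedge_form_is_linear b).

Lemma kdiffE f S :
  kdiff f S = \sum_(j | j \notin S) (x j * ksign j S) *: f (j |: S).
Proof.
rewrite kdiff_def sum_ffunE [RHS]big_mkcond; apply: eq_bigr => j _.
by rewrite !chainE; case: ifP => //= jS; rewrite ?scaler0 ?scalerA.
Qed.

Lemma wedge_form_subZ b (c : R) f g :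
  wedge_form b (f - c *: g) = wedge_form b f - c *: wedge_form b g.
Proof. by rewrite linearB linearZ. Qed.

Lemma kdiff_sq f : kdiff (kdiff f) = 0.
Proof.
rewrite !kdiff_def.
under eq_bigr => j _ do rewrite linear_sum /= scaler_sumr.
pose T j k := x j *: contr j (x k *: contr k f).
have Tanti j k : T j k = - T k j.
  rewrite /T !linearZ /= !scalerA [x k * _]mulrC.
  have [->|jk] := eqVneq j k; first by rewrite contr_self oppr0 !scaler0.
  by rewrite (contr_anti _ jk).
have Tself j : T j j = 0 by rewrite /T linearZ /= contr_self !scaler0.
rewrite pair_big /= (bigID (fun p : 'I_N * 'I_N => (p.1 < p.2)%N)) /=.
rewrite [X in _ + X](bigID (fun p : 'I_N * 'I_N => (p.2 < p.1)%N)) /=.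
rewrite [X in _ + (_ + X)]big1 ?addr0.
  rewrite [X in _ + X](reindex_inj (h := fun p => (p.2, p.1))) /=; last first.
    by move=> [a b] [c e] /= [-> ->].
  rewrite [X in _ + X](eq_bigl (fun p : 'I_N * 'I_N => (p.1 < p.2)%N)); last first.
    by move=> [a b] /=; case: (ltngtP a b).
  rewrite -big_split big1 //= => -[a b] _ /=.
  by rewrite -/(T a b) -/(T b a) Tanti addNr.
move=> [a b] /=; case: (ltngtP a b) => // /val_inj -> _.
exact: Tself.
Qed.

(** Exterior multiplication by \sum b_j e_j is a homotopy from the
    multiplication by \sum b_j x_j to zero, so this linear combination of the
    [x j] kills Koszul homology. *)
Lemma kdiff_wedge b f :
  kdiff (wedge_form b f) + wedge_form b (kdiff f) = (\sum_j b j * x j) *: f.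
Proof.
rewrite [kdiff (wedge_form b f)]kdiff_def [wedge_form b (kdiff f)]wedge_form_def.
rewrite [wedge_form b f]wedge_form_def [kdiff f]kdiff_def.
under eq_bigr => j _ do rewrite linear_sum /= scaler_sumr.
under [X in _ + X]eq_bigr => j _ do rewrite linear_sum /= scaler_sumr.
rewrite [X in _ + X]exchange_big /= -big_split scaler_suml /=.
apply: eq_bigr => j _; rewrite -big_split /=.
rewrite (bigD1 j) //= big1 ?addr0 => [|k kj].
  by rewrite !linearZ /= !scalerA [x j * _]mulrC -scalerDr contr_wedge_self.
rewrite !linearZ /= !scalerA [x j * _]mulrC -scalerDr contr_wedge_anti ?scaler0 //.
by rewrite eq_sym.
Qed.

End Koszul.

Section KoszulMap.
Context (N : nat) (R : comNzRingType) (M M' : lmodType R) (x : 'I_N -> R).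

Definition chain_map (h : M -> M') (f : {ffun {set 'I_N} -> M}) :
  {ffun {set 'I_N} -> M'} := [ffun S => h (f S)].

Lemma chain_mapE h f S : chain_map h f S = h (f S).
Proof. by rewrite ffunE. Qed.

Lemma chain_map_subZ (h : {linear M -> M'}) (c : R) f g :
  chain_map h (f - c *: g) = chain_map h f - c *: chain_map h g.
Proof.
apply/ffunP=> S; rewrite chain_subE chain_scaleE !chain_mapE.
by rewrite chain_subE chain_scaleE linearB linearZ.
Qed.

Lemma kdiff_map (h : {linear M -> M'}) f :
  kdiff x (chain_map h f) = chain_map h (kdiff x f).
Proof.
apply/ffunP=> S; rewrite ffunE !kdiffE linear_sum /=; apply: eq_bigr => j _.
by rewrite linearZ ffunE.
Qed.

End KoszulMap.

(** Cartan's formula for Lie derivatives, with [D i] in the role of the partial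
    derivative along the i-th variable: the two sums on the right of
    [cartan_htpyE] measure the polynomial and the exterior degree. *)
Section KoszulCartan.
Context (N : nat) (R : comNzRingType) (M : lmodType R) (x : 'I_N -> R).
Local Notation chain := {ffun {set 'I_N} -> M}.
Context (D : 'I_N -> {additive chain -> chain}).
Hypothesis D_contr : forall i j f, D i (contr j f) = contr j (D i f).
Hypothesis D_scale : forall i j f, D i (x j *: f) = (i == j)%:R *: f + x j *: D i f.

Definition cartan_htpy f : chain := \sum_i wedge i (D i f).

Lemma wedge_contr_count (f : chain) (S : {set 'I_N}) :
  (\sum_i wedge i (contr i f)) S = #|S|%:R *: f S.
Proof.
rewrite sum_ffunE -sum1_card natr_sum scaler_suml [RHS]big_mkcond /=.
apply: eq_bigr => i _; rewrite !chainE; case: ifP => // iS.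
rewrite !inE eqxx /= scalerA setD1K //.
by rewrite {1}(ksignD1 _ _ iS) ltnn mul1r ksign_sq.
Qed.

Lemma cartan_htpyE (f : chain) :
  kdiff x (cartan_htpy f) + cartan_htpy (kdiff x f) =
  \sum_i x i *: D i f + \sum_i wedge i (contr i f).
Proof.
rewrite [kdiff x (cartan_htpy f)]kdiff_def {1}/cartan_htpy.
under eq_bigr => i _ do rewrite linear_sum /= scaler_sumr.
rewrite exchange_big /=.
have -> : cartan_htpy (kdiff x f) = \sum_i wedge i (contr i f) +
    \sum_i \sum_j x j *: wedge i (contr j (D i f)).
  rewrite /cartan_htpy -big_split /=; apply: eq_bigr => i _.
  rewrite kdiff_def raddf_sum linear_sum /=.
  under eq_bigr => j _ do rewrite D_scale D_contr linearD !linearZ /=.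
  rewrite big_split /=; congr (_ + _).
  rewrite (bigD1 i) //= eqxx scale1r big1 ?addr0 // => j ji.
  by rewrite eq_sym (negbTE ji) scale0r.
rewrite addrCA addrC; congr (_ + _); rewrite -big_split; apply: eq_bigr => i _ /=.
rewrite -big_split (bigD1 i) //= big1 ?addr0 => [|j ji].
  by rewrite -scalerDr contr_wedge_self.
by rewrite -scalerDr contr_wedge_anti ?scaler0.
Qed.

End KoszulCartan.

(** * Graded pieces of free modules *)

Section ShiftedParts.
Context {K : fieldType} {N : nat}.
Local Notation R := {mpoly K[N]}.
Implicit Types p q : R.

Lemma mcoeff_pihomog d p m :
  (pihomog mdeg d p)@_m = if mdeg m == d then p@_m else 0.
Proof.
rewrite /pihomog big_mkcond raddf_sum /=.
rewrite (eq_bigr (fun m' => if mdeg m == d then (p@_m' *: 'X_[m'])@_m else 0)).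
  case: ifP => _; last by rewrite big1.
  by rewrite -raddf_sum -mpolyE.
move=> m' _; have [->//|ne] := eqVneq m' m.
  by case: ifP => _; rewrite ?mcoeff0.
rewrite mcoeffZ mcoeffX (negbTE ne) mulr0; case: (mdeg m' == d); last first.
  by rewrite mcoeff0; case: ifP.
by rewrite mcoeffZ mcoeffX (negbTE ne) mulr0; case: ifP.
Qed.

(** Degree [j] part in the twisted module R(-s), whose generator has degree [s]. *)
Definition hpart (s j : nat) p : R :=
  if (s <= j)%N then pihomog mdeg (j - s) p else 0.

Lemma mcoeff_hpart s j p m :
  (hpart s j p)@_m = if (mdeg m + s == j)%N then p@_m else 0.
Proof.
rewrite /hpart; case: leqP => sj.
  by rewrite mcoeff_pihomog -(eqn_add2r s) subnK.
rewrite mcoeff0; case: eqP => // e; move: sj; rewrite -e.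
by rewrite ltnNge leq_addl.
Qed.

Lemma hpart_is_linear s j : linear (hpart s j).
Proof.
move=> c p q; apply/mpolyP=> m; rewrite mcoeffD mcoeffZ !mcoeff_hpart.
by rewrite mcoeffD mcoeffZ; case: ifP; rewrite ?mulr0 ?addr0.
Qed.
HB.instance Definition _ s j :=
  GRing.isLinear.Build K R R _ (hpart s j) (hpart_is_linear s j).

Lemma hpart_id s j p : hpart s j (hpart s j p) = hpart s j p.
Proof. by apply/mpolyP=> m; rewrite !mcoeff_hpart; case: (_ == j). Qed.

Lemma hpartP s j p :
  hpart s j p = p <-> (forall m, m \in msupp p -> mdeg m + s = j)%N.
Proof.
split=> [e m|H].
  by rewrite mcoeff_msupp -e mcoeff_hpart; case: (_ =P j) => //; rewrite eqxx.
apply/mpolyP=> m; rewrite mcoeff_hpart; case: eqP => // ne.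
by apply/esym/eqP; rewrite mcoeff_eq0; apply/negP=> /H.
Qed.

Lemma hpartMX s' j a p s : (forall m, m \in msupp p -> mdeg m + s' = s)%N ->
  hpart s' j ('X_[a] * p) = if (mdeg a + s == j)%N then 'X_[a] * p else 0.
Proof.
move=> H; apply/mpolyP=> m; rewrite mcoeff_hpart mulrC.
have [/eqP m0|] := boolP ((p * 'X_[a])@_m == 0).
  by case: ifP => _; case: ifP => _; rewrite ?mcoeff0 ?m0.
rewrite -mcoeff_msupp (perm_mem (msuppMX p a)) => /mapP[b bp ->].
by rewrite mdegD -addnA (H _ bp); case: ifP; rewrite ?mcoeff0.
Qed.

(** Multiplication by a form of degree [s - s'] is a map R(-s) -> R(-s') of
    degree 0. Koszul differentials and the matrices of a graded resolution are
    both made of such maps. *)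
Lemma hpartM s s' j v p : (forall m, m \in msupp p -> mdeg m + s' = s)%N ->
  hpart s' j (v * p) = hpart s j v * p.
Proof.
move=> H; rewrite [v]mpolyE mulr_suml !linear_sum /= mulr_suml.
apply: eq_bigr => a _; rewrite -scalerAl !linearZ /= -scalerAl; congr (_ *: _).
rewrite (hpartMX _ _ H).
have -> : hpart s j 'X_[a] = if (mdeg a + s == j)%N then 'X_[a] else 0 :> R.
  apply/mpolyP=> m; rewrite mcoeff_hpart mcoeffX; case: (eqVneq a m) => [->|ne] /=.
    by case: ifP; rewrite ?mcoeff0 // mcoeffX eqxx.
  by case: ifP; case: ifP; rewrite ?mcoeff0 // mcoeffX (negbTE ne).
by case: ifP; rewrite // mul0r.
Qed.

Lemma hpart_addS s j c p : hpart (s + c) (j + c) p = hpart s j p.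
Proof. by apply/mpolyP=> m; rewrite !mcoeff_hpart addnA eqn_add2r. Qed.

Lemma hpart_sum s B p : (forall m, m \in msupp p -> mdeg m + s < B)%N ->
  p = \sum_(j < B) hpart s j p.
Proof.
move=> H; apply/mpolyP=> m; rewrite raddf_sum /=.
under eq_bigr => j _ do rewrite mcoeff_hpart.
have [/H mB|] := boolP (m \in msupp p).
  rewrite (bigD1 (Ordinal mB)) //= eqxx big1 ?addr0 // => j ne.
  by rewrite ifN // eq_sym; apply: contraNneq ne => e; apply/eqP/val_inj.
rewrite -mcoeff_eq0 => /eqP ->; rewrite big1 // => j _; by case: ifP.
Qed.

Lemma euler_mpoly d p : p \is d.-homog ->
  \sum_i 'X_i * p^`M(i) = d%:R *: p.
Proof.
move=> /dhomogP hp; rewrite {1 2}[p]mpolyE scaler_sumr.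
under eq_bigr => i _ do rewrite raddf_sum /= mulr_sumr.
rewrite exchange_big /= big_seq [RHS]big_seq; apply: eq_bigr => m mp.
have XD i : 'X_i * ('X_[m])^`M(i) = (m i)%:R *: 'X_[m] :> R.
  rewrite mderivX -scalerAr -mpolyXD.
  case: (posnP (m i)) => [->|mi]; first by rewrite !scale0r.
  by rewrite addmC submK // lep1mP -lt0n.
under eq_bigr => i _ do rewrite linearZ /= -scalerAr XD scalerA mulrC -scalerA.
by rewrite -scaler_suml -natr_sum -mdegE (hp _ mp).
Qed.

End ShiftedParts.

Section GradedFree.
Context {K : fieldType} {N k : nat} (sh : 'I_k -> nat).
Local Notation R := {mpoly K[N]}.
Local Notation M := 'rV[R]_k.
Local Notation chain := {ffun {set 'I_N} -> M}.
Local Notation X := (fun i : 'I_N => 'X_i : R).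
Local Notation kd := (kdiff X).

(** The additional twist [c] leaves room for the exterior degree of a chain. *)
Definition vpart (c j : nat) (v : M) : M := \row_l hpart (sh l + c) j (v 0 l).

Lemma vpart_is_additive c j : additive (vpart c j).
Proof. by move=> u v; apply/rowP=> l; rewrite !mxE raddfB. Qed.
HB.instance Definition _ c j :=
  GRing.isAdditive.Build M M (vpart c j) (vpart_is_additive c j).

(** Component of exterior degree [q] and total degree [j], where e_S has degree
    #|S|. *)
Definition cpart (q j : nat) (f : chain) : chain :=
  [ffun S : {set 'I_N} => if #|S| == q then vpart #|S| j (f S) else 0].

Definition chom q j (f : chain) := cpart q j f = f.

Lemma cpart_is_additive q j : additive (cpart q j).
Proof.
move=> f g; apply/ffunP=> S; rewrite !ffunE; case: ifP => _; rewrite ?raddfB //.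
by rewrite subr0.
Qed.
HB.instance Definition _ q j :=
  GRing.isAdditive.Build chain chain (cpart q j) (cpart_is_additive q j).

Lemma cpart_hom q j f : chom q j (cpart q j f).
Proof.
apply/ffunP=> S; rewrite !ffunE; case: (_ == q) => //.
by apply/rowP=> l; rewrite !mxE hpart_id.
Qed.

Lemma chomP q j f : chom q j f <->
  (forall S l m, m \in msupp (f S 0 l) -> #|S| = q /\ (mdeg m + sh l + q = j)%N).
Proof.
split=> [H S l m mS|H].
  move: mS; rewrite -H ffunE; case: eqP => [<-|ne]; last by rewrite mxE msupp0.
  rewrite mxE mcoeff_msupp mcoeff_hpart; case: (_ =P j) => [<-|]; rewrite ?eqxx //.
  by rewrite addnA.
apply/ffunP=> S; rewrite ffunE; case: eqP => [e|ne].
  apply/rowP=> l; rewrite mxE; apply/hpartP => m /H[_].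
  by rewrite e addnA.
apply/rowP=> l; rewrite mxE; apply/esym/eqP; rewrite -msupp_eq0.
case E: (msupp _) => [//|m s]; have /H[/ne]: m \in msupp (f S 0 l) by rewrite E mem_head.
by [].
Qed.

Lemma chom_card q j f (S : {set 'I_N}) : chom q j f -> #|S| != q -> f S = 0.
Proof. by move=> <- /negbTE ne; rewrite ffunE ne. Qed.

Lemma chomB q j f g : chom q j f -> chom q j g -> chom q j (f - g).
Proof. rewrite /chom => hf hg; by rewrite raddfB /= hf hg. Qed.

Lemma chomZ q j (c : K) f : chom q j f -> chom q j (c%:MP *: f).
Proof.
move=> /chomP hf; apply/chomP=> S l m; rewrite ffunE mxE mul_mpolyC => /msuppZ_le.
exact: hf.
Qed.

(** The differential preserves the total degree; statements about chains can
    therefore be projected to a single bidegree. *)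
Lemma kdiff_cpart q j f : kd (cpart q.+1 j f) = cpart q j (kd f).
Proof.
apply/ffunP=> S; rewrite kdiffE ffunE kdiffE.
case: eqP => [e|ne]; last first.
  apply: big1 => i iS; rewrite ffunE cardsU1 iS add1n eqSS.
  by case: eqP => [/ne|]; rewrite ?scaler0.
rewrite raddf_sum /=; apply: eq_bigr => i iS.
rewrite ffunE cardsU1 iS add1n eqSS e eqxx.
apply/rowP=> l; rewrite !mxE /ksign -signr_odd.
set b := odd _; set p := f _ _ _.
have hX : hpart (sh l + q) j ('X_i * p) = 'X_i * hpart (sh l + q.+1) j p.
  rewrite mulrC [RHS]mulrC; apply: hpartM => m.
  by rewrite msuppX inE => /eqP ->; rewrite mdeg1 addnS add1n.
by case: b; rewrite ?mulrN1 ?mulr1 ?mulNr ?raddfN /= hX.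
Qed.

End GradedFree.

(** * Exactness of the Koszul complex in characteristic zero *)

Section EulerHomotopy.
Context {K : fieldType} {N k : nat} (sh : 'I_k -> nat).
Local Notation R := {mpoly K[N]}.
Local Notation M := 'rV[R]_k.
Local Notation chain := {ffun {set 'I_N} -> M}.
Local Notation X := (fun i : 'I_N => 'X_i : R).
Local Notation kd := (kdiff X).
Implicit Types f g : chain.

Definition chain_deriv (i : 'I_N) f : chain := chain_map (map_mx (mderiv i)) f.

Lemma chain_derivE i f S : chain_deriv i f S = map_mx (mderiv i) (f S).
Proof. by rewrite ffunE. Qed.

Lemma chain_deriv_is_additive i : additive (chain_deriv i).
Proof.
move=> f g; apply/ffunP=> S.
by rewrite chain_subE !chain_derivE chain_subE map_mxB.
Qed.
HB.instance Definition _ i :=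
  GRing.isAdditive.Build chain chain (chain_deriv i) (chain_deriv_is_additive i).

Lemma chain_deriv_contr i j f : chain_deriv i (contr j f) = contr j (chain_deriv i f).
Proof.
apply/ffunP=> S; rewrite chain_derivE !contrE; case: ifP => _; first exact: map_mx0.
rewrite chain_derivE; apply/rowP=> l; rewrite !mxE /ksign -signr_odd.
by case: (odd _); rewrite ?mulN1r ?mul1r ?raddfN.
Qed.

Lemma chain_derivX i j f :
  chain_deriv i ('X_j *: f) = (i == j)%:R *: f + 'X_j *: chain_deriv i f.
Proof.
apply/ffunP=> S; apply/rowP=> l; rewrite !(chain_addE, chain_scaleE, chain_derivE) !mxE.
rewrite mderivM; congr (_ * _ + _).
rewrite mderivX mnm1E eq_sym; case: eqP => [->|_]; last by rewrite scale0r.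
by rewrite -{1}[U_(_)%MM]add0m addmK mpolyX0 scale1r.
Qed.

Definition euler_htpy f : chain :=
  cartan_htpy (fun i => chain_deriv i : {additive chain -> chain}) f.

(** In total degree [j] the polynomial and exterior degrees of the l-th coordinate
    add up to [j - sh l], so Cartan's formula becomes Euler's relation. *)
Lemma euler_htpy_hom q j f S l : chom sh q j f ->
  (kd (euler_htpy f) + euler_htpy (kd f)) S 0 l = (j - sh l)%:R *: f S 0 l.
Proof.
move=> /chomP hf; rewrite (cartan_htpyE chain_deriv_contr chain_derivX) ffunE.
rewrite wedge_contr_count sum_ffunE mxE summxE.
rewrite (eq_bigr (fun i => 'X_i * (f S 0 l)^`M(i))) => [|i _]; last first.
  by rewrite ffunE mxE ffunE mxE.
rewrite [(_ *: f S) 0 l]mxE.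
have [p0|nz] := eqVneq (f S 0 l) 0.
  by rewrite p0 mulr0 addr0 scaler0 big1 // => i _; rewrite raddf0 mulr0.
have [e ed] := hf _ _ _ (mlead_supp nz).
have hom : f S 0 l \is (j - sh l - q).-homog.
  by apply/dhomogP=> m /hf[_ <-]; rewrite -addnA -subnDA addnK.
rewrite (euler_mpoly hom) e -mul_mpolyC rmorph_nat -mulrDl -natrD subnK.
  by rewrite -mul_mpolyC rmorph_nat.
by rewrite -ed; lia.
Qed.

Hypothesis charK0 : [pchar K] =i pred0.

(** Euler's relation divided by the degree contracts the complex. This fails only
    in degree 0, that is, on constants in exterior degree 0, which the last
    hypothesis excludes. *)
Lemma koszul_exact q j f : chom sh q j f -> kd f = 0 ->
  (forall l, q = 0%N -> (f set0 0 l)@_0%MM = 0) ->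
  exists2 g, chom sh q.+1 j g & kd g = f.
Proof.
move=> hf df f0.
have Hf S l : (j - sh l)%N = 0%N -> f S 0 l = 0.
  move=> jl; apply/eqP; rewrite -msupp_eq0; apply/negPn/negP => nz.
  have {nz} /mlead_supp mS : f S 0 l != 0 by rewrite -msupp_eq0.
  have [Sq] := (chomP _ _ _ _).1 hf _ _ _ mS.
  move=> e; have /eqP : (mdeg (mlead (f S 0%R l)) + q = 0)%N.
    by lia.
  rewrite addn_eq0 mdeg_eq0 => /andP[/eqP m0 /eqP q0].
  move: mS; rewrite mcoeff_msupp m0; have -> : S = set0 by apply: cards0_eq; rewrite Sq.
  by rewrite f0 ?eqxx.
(* division by the degree; a coordinate of degree 0 vanishes, so the value
   of 0^-1 does not matter *)
pose D : 'M[R]_k := diag_mx (\row_l ((j - sh l)%:R^-1)%:MP).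
have DE v l : (mulmxr D v) 0 l = (j - sh l)%:R^-1 *: v 0 l :> R.
  by rewrite /= mul_mx_diag !mxE mulrC mul_mpolyC.
exists (cpart sh q.+1 j (chain_map (mulmxr D) (euler_htpy f))); first exact: cpart_hom.
rewrite kdiff_cpart kdiff_map -[RHS]hf; congr (cpart sh q j _).
apply/ffunP=> S; apply/rowP=> l; rewrite ffunE DE.
have := euler_htpy_hom S l hf; rewrite df /euler_htpy [X in _ + X]big1 ?addr0; last first.
  by move=> i _; rewrite raddf0 linear0.
move=> ->; have [jl|] := posnP (j - sh l)%N; first by rewrite (Hf _ _ jl) !scaler0.
rewrite lt0n => jl; rewrite scalerA mulVf ?scale1r //.
by rewrite ((pcharf0P K).1 charK0).
Qed.

End EulerHomotopy.

(** * Koszul homology along a free presentation *)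

Section Submodules.
Context {K : fieldType} {N k : nat} (sh : 'I_k -> nat).
Local Notation R := {mpoly K[N]}.
Local Notation M := 'rV[R]_k.
Local Notation chain := {ffun {set 'I_N} -> M}.
Local Notation X := (fun i : 'I_N => 'X_i : R).
Local Notation kd := (kdiff X).
Implicit Types (f g : chain) (Q : M -> Prop).

Record gsubmod Q : Prop := GSubmod {
  gsub0 : Q 0;
  gsubD : forall u v, Q u -> Q v -> Q (u + v);
  gsubZ : forall p u, Q u -> Q (p *: u);
  gsub_part : forall c j u, Q u -> Q (vpart sh c j u) }.

Lemma gsubB Q u v : gsubmod Q -> Q u -> Q v -> Q (u - v).
Proof. by move=> HQ Qu Qv; rewrite -scaleN1r; apply: gsubD => //; apply: gsubZ. Qed.

Lemma gsub_sum Q (I : Type) (r : seq I) (P : pred I) (F : I -> M) :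
  gsubmod Q -> (forall i, P i -> Q (F i)) -> Q (\sum_(i <- r | P i) F i).
Proof.
move=> HQ H; elim/big_ind: _ => //; first exact: (gsub0 HQ).
exact: (gsubD HQ).
Qed.

(** Koszul cycles and boundaries of the quotient of the free module by [Q], in
    terms of representatives. *)
Definition cycle_mod Q f : Prop := forall S, Q (kd f S).
Definition boundary_mod Q f : Prop := exists u : chain, forall S, Q (f S - kd u S).

Lemma chain_valued_kdiff Q f : gsubmod Q -> (forall S, Q (f S)) -> cycle_mod Q f.
Proof.
by move=> HQ Qf S; rewrite kdiffE; apply: gsub_sum => // i _; apply: gsubZ.
Qed.

Lemma boundary_cpart Q q j f : gsubmod Q -> chom sh q j f -> boundary_mod Q f ->
  exists2 u, chom sh q.+1 j u &
    chom sh q j (f - kd u) /\ forall S, Q ((f - kd u) S).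
Proof.
move=> HQ hf [u Qu]; exists (cpart sh q.+1 j u); first exact: cpart_hom.
rewrite kdiff_cpart -{1 2}hf -raddfB; split; first exact: cpart_hom.
move=> S; rewrite ffunE; case: ifP => _; last exact: (gsub0 HQ).
by apply: (gsub_part HQ); rewrite !ffunE.
Qed.

Lemma chom_kdiff q j f : chom sh q.+1 j f -> chom sh q j (kd f).
Proof. by rewrite /chom -kdiff_cpart => ->. Qed.

End Submodules.

Section GradedMap.
Context {K : fieldType} {N k k' : nat} (sh : 'I_k -> nat) (sh' : 'I_k' -> nat).
Local Notation R := {mpoly K[N]}.
Local Notation X := (fun i : 'I_N => 'X_i : R).
Local Notation kd := (kdiff X).
Context (phi : 'M[R]_(k', k)).

Definition graded_mx : Prop := forall i l m, m \in msupp (phi i l) ->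
  (mdeg m + sh l)%N = sh' i.

Hypothesis phiG : graded_mx.

Lemma vpart_mulmx c j v : vpart sh c j (v *m phi) = vpart sh' c j v *m phi.
Proof.
apply/rowP=> l; rewrite !mxE linear_sum; apply: eq_bigr => i _.
rewrite !mxE; apply: hpartM => m /phiG <-; by rewrite addnA.
Qed.

Lemma cpart_chain_map q j (f : {ffun {set 'I_N} -> 'rV[R]_k'}) :
  cpart sh q j (chain_map (mulmxr phi) f) = chain_map (mulmxr phi) (cpart sh' q j f).
Proof.
apply/ffunP=> S; rewrite !ffunE; case: ifP => _; rewrite ?raddf0 //.
exact: vpart_mulmx.
Qed.

Lemma gsubmod_im (Q : 'rV[R]_k -> Prop) :
  (forall v, Q v <-> exists w, v = w *m phi) -> gsubmod sh Q.
Proof.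
move=> HQ; split.
- by apply/HQ; exists 0; rewrite mul0mx.
- by move=> u v /HQ[u' ->] /HQ[v' ->]; apply/HQ; exists (u' + v'); rewrite mulmxDl.
- by move=> p u /HQ[u' ->]; apply/HQ; exists (p *: u'); rewrite -scalemxAl.
- move=> c j u /HQ[u' ->]; apply/HQ; exists (vpart sh' c j u').
  exact: vpart_mulmx.
Qed.

Lemma gsubmod_ker (Q' : 'rV[R]_k' -> Prop) :
  (forall w, Q' w <-> w *m phi = 0) -> gsubmod sh' Q'.
Proof.
move=> HQ; split.
- by apply/HQ; rewrite mul0mx.
- by move=> u v /HQ hu /HQ hv; apply/HQ; rewrite mulmxDl hu hv addr0.
- by move=> p u /HQ hu; apply/HQ; rewrite -scalemxAl hu scaler0.
- by move=> c j u /HQ hu; apply/HQ; rewrite -vpart_mulmx hu raddf0.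
Qed.

Context (Q : 'rV[R]_k -> Prop) (Q' : 'rV[R]_k' -> Prop).
Hypothesis charK0 : [pchar K] =i pred0.
Hypothesis phi_min : forall i l, (phi i l)@_0%MM = 0.
Hypothesis imphi : forall v, Q v <-> exists w, v = w *m phi.
Hypothesis kerphi : forall w, Q' w <-> w *m phi = 0.

(** The connecting map H_(q+1)(F/Q) -> H_q(Q) = H_q(F'/Q') of Koszul homology,
    as a relation between representing chains. The lemmas below show that it is
    an isomorphism. *)
Definition connected (w : {ffun {set 'I_N} -> 'rV[R]_k})
    (w' : {ffun {set 'I_N} -> 'rV[R]_k'}) : Prop :=
  kd w = chain_map (mulmxr phi) w'.

Lemma connected_cycle w w' : connected w w' -> cycle_mod Q w.
Proof. by move=> e S; rewrite e ffunE; apply/imphi; exists (w' S). Qed.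

Lemma connected_cycle' w w' : connected w w' -> cycle_mod Q' w'.
Proof.
move=> e S; apply/kerphi; have := kdiff_sq X w; rewrite e kdiff_map.
by move/ffunP/(_ S); rewrite !ffunE.
Qed.

Lemma connected_lift q j w : chom sh q.+1 j w -> cycle_mod Q w ->
  exists2 w', chom sh' q j w' & connected w w'.
Proof.
move=> hw cw.
have [F HF] : exists F : {set 'I_N} -> _, forall S, kd w S = F S *m phi.
  by apply: (fin_all_exists (P := fun S u => kd w S = u *m phi)) => S; apply/imphi.
exists (cpart sh' q j (finfun F)); first exact: cpart_hom.
rewrite /connected -cpart_chain_map -(chom_kdiff hw); congr (cpart _ _ _ _).
by apply/ffunP=> S; rewrite !ffunE HF.
Qed.

(** Surjectivity: the image of [w'] in F is a cycle of an exact complex. In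
    exterior degree 0 exactness asks for vanishing constant terms, which
    minimality of [phi] provides. *)
Lemma connected_colift q j w' : chom sh' q j w' -> cycle_mod Q' w' ->
  exists2 w, chom sh q.+1 j w & connected w w'.
Proof.
move=> hw cw.
have [|||w hh e] := @koszul_exact _ _ _ sh charK0 q j (chain_map (mulmxr phi) w').
- by rewrite /chom cpart_chain_map hw.
- by rewrite kdiff_map; apply/ffunP=> S; rewrite !ffunE; apply/kerphi.
- move=> l _; rewrite ffunE mxE raddf_sum big1 // => i _ /=.
  by rewrite rmorphM /= phi_min mulr0.
by exists w.
Qed.

(** If w = d u + v phi, then w' - d v is killed by phi. Conversely, if w' - d v is
    killed by phi, then w - v phi is a cycle, hence a boundary, in the exact
    Koszul complex of F. *)
Lemma connected_boundary q j w w' : chom sh q.+1 j w -> chom sh' q j w' ->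
  connected w w' -> boundary_mod Q w <-> boundary_mod Q' w'.
Proof.
move=> hw hw' e; split.
  move=> /(boundary_cpart (gsubmod_im imphi) hw)[u hu [_ Qu]].
  have [F HF] : exists F : {set 'I_N} -> _, forall S, (w - kd u) S = F S *m phi.
    by apply: (fin_all_exists (P := fun S v => (w - kd u) S = v *m phi)) => S; apply/imphi.
  exists (finfun F) => S; apply/kerphi; rewrite mulmxBl.
  have -> : w' S *m phi = kd w S by rewrite e ffunE.
  have -> : kd (finfun F) S *m phi = kd (w - kd u) S.
    transitivity (chain_map (mulmxr phi) (kd (finfun F)) S); first by rewrite ffunE.
    rewrite -kdiff_map; congr (kd _ S); apply/ffunP=> T; rewrite HF.
    by rewrite ffunE ffunE.
  by rewrite raddfB /= kdiff_sq subr0 subrr.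
move=> /(boundary_cpart (gsubmod_ker kerphi) hw')[v hv [_ Qv]].
have hv' : chom sh q.+1 j (chain_map (mulmxr phi) v) by rewrite /chom cpart_chain_map hv.
have [|||u hu eu] := @koszul_exact _ _ _ sh charK0 q.+1 j (w - chain_map (mulmxr phi) v).
- exact: chomB.
- rewrite raddfB /= e kdiff_map; apply/ffunP=> S.
  by move/kerphi: (Qv S); rewrite !ffunE mulmxBl.
- by [].
exists u => S; apply/imphi; exists (v S); rewrite eu !ffunE /=.
by rewrite opprB addrCA subrr addr0.
Qed.

End GradedMap.

(** * Cutting by a linear non-zero-divisor *)

Section HomogeneousIdeals.
Context {K : fieldType} {N : nat}.
Local Notation R := {mpoly K[N]}.

Record hideal (I : R -> Prop) : Prop := HIdeal {
  hid0 : I 0;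
  hidD : forall f g, I f -> I g -> I (f + g);
  hidM : forall p f, I f -> I (p * f);
  hidH : forall d f, I f -> I (pihomog mdeg d f) }.

Section Rows.
Context (I : R -> Prop) (HI : hideal I) (k : nat).
Local Notation M := 'rV[R]_k.

Definition rowI (P : R -> Prop) (v : M) : Prop := forall i, P (v 0 i).
Definition sh0 : 'I_k -> nat := fun=> 0%N.

Lemma rowI_gsubmod : gsubmod sh0 (rowI I).
Proof.
split.
- by move=> i; rewrite mxE; apply: hid0.
- by move=> u v hu hv i; rewrite mxE; apply: hidD.
- by move=> p u hu i; rewrite mxE; apply: hidM.
- move=> c j u hu i; rewrite mxE /hpart; case: ifP => _; last exact: hid0.
  exact: hidH.
Qed.

End Rows.

Section PlusLinear.
Context (I : R -> Prop) (HI : hideal I) (b : 'I_N -> K).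

Definition lform : R := \sum_i (b i)%:MP * 'X_i.

Lemma lform_homog : lform \is 1.-homog.
Proof.
apply: rpred_sum => i _; rewrite mul_mpolyC; apply: rpredZ.
by rewrite dhomogX /= mdeg1.
Qed.

Lemma pihomog_lform d v : pihomog mdeg d (lform * v) = lform * hpart 1 d v.
Proof.
have := @hpartM _ _ 1 0 d v lform; rewrite /hpart /= subn0 mulrC => -> //.
  by rewrite mulrC.
by move=> m /(dhomog_mf lform_homog); rewrite addn0.
Qed.

Definition plus_l (f : R) : Prop := exists u v, I u /\ f = u + lform * v.

Lemma plus_lI f : I f -> plus_l f.
Proof. by exists f, 0; rewrite mulr0 addr0. Qed.

Lemma plus_l_mul f : plus_l (lform * f).
Proof. by exists 0, f; rewrite add0r; split=> //; apply: hid0. Qed.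

Lemma plus_l_hideal : hideal plus_l.
Proof.
split.
- by apply: plus_lI; apply: hid0.
- move=> _ _ [u [v [Iu ->]]] [u' [v' [Iu' ->]]]; exists (u + u'), (v + v').
  by split; [exact: hidD | rewrite mulrDr addrACA].
- move=> p _ [u [v [Iu ->]]]; exists (p * u), (p * v).
  by split; [exact: hidM | rewrite mulrDr mulrCA].
- move=> d _ [u [v [Iu ->]]]; exists (pihomog mdeg d u), (hpart 1 d v).
  by split; [exact: hidH | rewrite raddfD /= pihomog_lform].
Qed.

End PlusLinear.

End HomogeneousIdeals.

Section NonZeroDivisor.
Context {K : fieldType} {n : nat}.
Local Notation N := n.+1.
Local Notation R := {mpoly K[N]}.
Local Notation X := (fun i : 'I_N => 'X_i : R).
Local Notation kd := (kdiff X).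
Context (I : R -> Prop) (HI : hideal I) (b : 'I_N -> K).
Local Notation lform := (lform b).
Local Notation plus_l := (plus_l I b).

Hypothesis nzd : forall f, I (lform * f) -> I f.

Context (k : nat).
Local Notation M := 'rV[R]_k.
Local Notation chain := {ffun {set 'I_N} -> M}.
Local Notation sh0 := (@sh0 k).
Local Notation QI := (rowI I).
Implicit Types (w : chain) (S : {set 'I_N}).

Let gsubmod_rowI := rowI_gsubmod HI k.
Let HJ := plus_l_hideal HI b.
Let gsubmod_JI := rowI_gsubmod HJ k.

Lemma rowI_nzd v : @rowI _ _ k I (lform *: v) -> QI v.
Proof. by move=> H i; apply: nzd; have := H i; rewrite mxE. Qed.

Lemma rowI_plus_l v : rowI plus_l v -> exists u (t : M), QI u /\ v = u + lform *: t.
Proof.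
move=> H; have [F HF] : exists F : 'I_k -> R * R, forall i, I (F i).1 /\
    v 0 i = (F i).1 + lform * (F i).2.
  apply: (fin_all_exists (P := fun i (p : R * R) => I p.1 /\ v 0 i = p.1 + lform * p.2)) => i.
  by have [p [q Hpq]] := H i; exists (p, q).
exists (\row_i (F i).1), (\row_i (F i).2); split.
  by move=> i; rewrite mxE; case: (HF i).
by apply/rowP=> i; rewrite !mxE; case: (HF i).
Qed.

Lemma chain_plus_l (w : chain) : (forall S, rowI plus_l (w S)) ->
  exists U V : chain, (forall S, QI (U S)) /\ w = U + lform *: V.
Proof.
move=> H; have [F HF] : exists F : {set 'I_N} -> M * M, forall S, QI (F S).1 /\
    w S = (F S).1 + lform *: (F S).2.
  apply: (fin_all_exists (P := fun S (p : M * M) => QI p.1 /\ w S = p.1 + lform *: p.2)) => S.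
  by have [p [q Hpq]] := rowI_plus_l (H S); exists (p, q).
exists [ffun S => (F S).1], [ffun S => (F S).2]; split.
  by move=> S; rewrite ffunE; case: (HF S).
by apply/ffunP=> S; rewrite !ffunE; case: (HF S).
Qed.

Definition wedge_l (w : chain) : chain := wedge_form (fun i => (b i)%:MP : R) w.

Lemma kdiff_wedge_l w : kd (wedge_l w) + wedge_l (kd w) = lform *: w.
Proof. exact: kdiff_wedge. Qed.

Lemma kdiff_wedge_lE w S : kd (wedge_l w) S + wedge_l (kd w) S = lform *: w S.
Proof. by rewrite -chain_addE kdiff_wedge_l chain_scaleE. Qed.

Lemma wedge_lE w S :
  wedge_l w S = \sum_(i in S) ((b i)%:MP * ksign R i S) *: w (S :\ i).
Proof.
rewrite /wedge_l wedge_form_def sum_ffunE [RHS]big_mkcond; apply: eq_bigr => i _.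
by rewrite !chainE; case: ifP => iS; rewrite ?scaler0 ?scalerA.
Qed.

Lemma rowI_wedge w : (forall S, QI (w S)) -> forall S, QI (wedge_l w S).
Proof.
move=> H S; rewrite wedge_lE; apply: (gsub_sum _ gsubmod_rowI) => i _.
exact: (gsubZ gsubmod_rowI).
Qed.

Lemma rowI_kdiff w : (forall S, QI (w S)) -> forall S, QI (kd w S).
Proof. exact: chain_valued_kdiff gsubmod_rowI. Qed.

Lemma chom_homog q j w S i : chom sh0 q j w -> w S 0 i \is (j - q).-homog.
Proof.
move=> /chomP hw; apply/dhomogP=> m /hw[_ <-]; by rewrite addn0 addnK.
Qed.

Lemma wedge_homog q j w S i : chom sh0 q j w -> wedge_l w S 0 i \is (j - q).-homog.
Proof.
move=> hw; rewrite wedge_lE summxE; apply: rpred_sum => l _.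
rewrite mxE -mulrA mul_mpolyC; apply: rpredZ.
rewrite /ksign -signr_odd; have := chom_homog (S :\ l) i hw.
by case: (odd _); rewrite ?mul1r ?mulN1r ?rpredN.
Qed.

(** If l /\ w = u + l v with u in I, applying d gives l w = l d v modulo I for a
    cycle w, and l cancels. *)
Lemma boundary_of_wedge w : cycle_mod QI w ->
  (forall S, rowI plus_l (wedge_l w S)) -> boundary_mod QI w.
Proof.
move=> cw /chain_plus_l[U [V [QU e]]]; exists V => S.
apply: rowI_nzd.
have -> : lform *: (w S - kd V S) = kd U S + wedge_l (kd w) S.
  have := kdiff_wedge_lE w S; rewrite e linearD linearZ /= chain_addE chain_scaleE.
  by rewrite scalerBr => <-; rewrite addrAC addrK.
apply: (gsubD gsubmod_rowI); first exact: rowI_kdiff.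
exact: rowI_wedge.
Qed.

(** This is how the Artinian reduction controls the regularity of R/I: for degree
    reasons l /\ w vanishes modulo I + (l). *)
Lemma cycle_bound D q j w :
  (forall e f, (D < e)%N -> f \is e.-homog -> plus_l f) ->
  chom sh0 q j w -> cycle_mod QI w -> (D + q < j)%N -> boundary_mod QI w.
Proof.
move=> HD hw cw jq; apply: (boundary_of_wedge cw) => S i.
by apply: (HD (j - q)%N); [lia | exact: wedge_homog].
Qed.

(** Here l /\ w = 0 for lack of room, so l w has coefficients in I, and l cancels. *)
Lemma cycle_top w : (forall S, S != setT -> w S = 0) -> cycle_mod QI w ->
  forall S, QI (w S).
Proof.
move=> hw cw S; apply: rowI_nzd.
have <- := kdiff_wedge_lE w S.
have -> : wedge_l w = 0.
  apply/ffunP=> T; rewrite wedge_lE big1 ?ffunE // => i iT.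
  rewrite hw ?scaler0 //; apply/eqP => /setP/(_ i).
  by rewrite !inE eqxx.
rewrite raddf0 chain0E add0r; exact: rowI_wedge.
Qed.

Lemma cycle_vanish q j w : (N <= q)%N ->
  chom sh0 q j w -> cycle_mod QI w -> forall S, QI (w S).
Proof.
move=> Nq hw; apply: cycle_top => S nT; apply: (chom_card hw).
have : (#|S| < #|[set: 'I_N]|)%N by rewrite proper_card // properT.
rewrite cardsT card_ord; lia.
Qed.

(** The map from n-cycles of R/I to the socle of R/(I + (l)) that takes [w] to the
    coefficient of l /\ w; up to boundaries it is an isomorphism. *)
Definition top_part w : M := wedge_l w setT.

Lemma kdiff_setD1 (f : chain) i : kd f (setT :\ i) = ('X_i * ksign R i (setT :\ i)) *: f setT.
Proof.
rewrite kdiffE (bigD1 i) ?inE ?eqxx //= setD1K ?inE // big1 ?addr0 // => j.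
by rewrite !inE => /andP[]; case: eqP.
Qed.

Lemma top_part_socle w i : cycle_mod QI w -> rowI plus_l ('X_i *: top_part w).
Proof.
move=> cw; have e := kdiff_wedge_lE w (setT :\ i).
rewrite (kdiff_setD1 (wedge_l w) i) -/(top_part w) in e.
have {e} : rowI plus_l (('X_i * ksign R i (setT :\ i)) *: top_part w).
  rewrite -[X in rowI _ X](addrK (wedge_l (kd w) (setT :\ i))) e.
  apply: (gsubB gsubmod_JI).
    by move=> l; rewrite mxE; apply: (plus_l_mul HI).
  by move=> l; apply: plus_lI; apply: rowI_wedge.
move=> H l; have := hidM HJ (ksign R i (setT :\ i)) (H l).
by rewrite !mxE mulrA mulrCA ksign_sq mulr1.
Qed.

Lemma top_part_boundary q j w : chom sh0 q j w -> cycle_mod QI w -> q = n ->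
  rowI plus_l (top_part w) <-> boundary_mod QI w.
Proof.
move=> hw cw qn; split=> [Jw|].
  apply: (boundary_of_wedge cw) => S; have [->//|nT] := eqVneq S setT.
  rewrite wedge_lE big1 => [|i iS]; first exact: (gsub0 (gsubmod_JI)).
  rewrite (chom_card hw) ?scaler0 // qn.
  have : (#|S| < #|[set: 'I_N]|)%N by rewrite proper_card // properT.
  rewrite cardsT card_ord (cardsD1 i S) iS; lia.
move=> [u Qu]; have -> : top_part w = top_part (w - kd u) + lform *: u setT.
  rewrite /top_part -{1}[w](subrK (kd u)) /wedge_l raddfD chain_addE; congr (_ + _).
  have <- := kdiff_wedge_lE u setT; rewrite kdiffE big_pred0 ?add0r // => i.
  by rewrite inE.
apply: (gsubD gsubmod_JI) => i.
  by apply: plus_lI; apply: rowI_wedge => S; rewrite !ffunE.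
by rewrite mxE; apply: (plus_l_mul HI).
Qed.

(** Surjectivity of [top_part]: the differential of g e_0 /\ .. /\ e_n has
    coefficients in I + (l), and its quotient by l is the cycle wanted. *)
Lemma socle_lift e (g : M) : (forall i, g 0 i \is e.-homog) ->
  (forall i, rowI plus_l ('X_i *: g)) ->
  exists w, [/\ chom sh0 n (e + n) w, cycle_mod QI w & QI (g - top_part w)].
Proof.
(* g e_0 /\ .. /\ e_n *)
move=> hg sg; pose topc : chain := [ffun S : {set 'I_N} => if S == setT then g else 0].
have htop : chom sh0 n.+1 (e + n).+1 topc.
  apply/chomP => S l m; rewrite ffunE; case: eqP => [->|_]; last by rewrite mxE msupp0.
  by move/(dhomog_mf (hg l)) => /= ->; rewrite cardsT card_ord addn0 addnS.
have [U [V [QU e0]]] : exists U V : chain, (forall S, QI (U S)) /\ kd topc = U + lform *: V.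
  apply: chain_plus_l => S; rewrite kdiffE; apply: (gsub_sum _ gsubmod_JI) => i _.
  rewrite mulrC -scalerA; apply: (gsubZ gsubmod_JI); rewrite ffunE.
  by case: eqP => _; rewrite ?scaler0; [exact: sg | exact: (gsub0 gsubmod_JI)].
pose U' := cpart sh0 n (e + n).+1 U; pose w := cpart sh0 n (e + n) V.
have QU' S : QI (U' S).
  rewrite ffunE; case: ifP => _; last exact: (gsub0 gsubmod_rowI).
  exact: (gsub_part gsubmod_rowI).
have {}e0 : kd topc = U' + lform *: w.
  rewrite -(chom_kdiff htop) e0 raddfD; congr (_ + _).
  apply/ffunP=> S; rewrite !ffunE; case: ifP => _; last by rewrite scaler0.
  apply/rowP=> i; rewrite !mxE  mulrC [RHS]mulrC.
  rewrite (@hpartM _ _ (#|S|.+1)) => [|m /(dhomog_mf (lform_homog b)) /= ->].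
    by rewrite -(hpart_addS _ _ 1) !addn1.
  by rewrite add1n.
have cw : cycle_mod QI w.
  move=> S; apply: rowI_nzd.
  have e1 : kd U' S + lform *: kd w S = 0.
    by rewrite -chain_scaleE -chain_addE -linearZ -linearD /= -e0 kdiff_sq chain0E.
  rewrite -(addr0_eq e1) -scaleN1r.
  by apply: (gsubZ gsubmod_rowI); apply: rowI_kdiff.
exists w; split=> //; first exact: cpart_hom.
have := @cycle_top (topc - wedge_l w); move=> /(_ _ _ setT); rewrite !ffunE eqxx; apply.
  move=> S nT; rewrite !ffunE (negbTE nT) wedge_lE big1 ?subr0 // => i iS.
  rewrite (@chom_card _ _ _ sh0 n (e + n)) ?scaler0 //; first exact: cpart_hom.
  have : (#|S| < #|[set: 'I_N]|)%N by rewrite proper_card // properT.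
  rewrite cardsT card_ord (cardsD1 i S) iS; lia.
move=> S; rewrite raddfB /= e0.
have -> : kd (wedge_l w) = lform *: w - wedge_l (kd w) by rewrite -kdiff_wedge_l addrK.
rewrite opprB addrCA addrC addrK [X in QI X]ffunE.
by apply: (gsubD gsubmod_rowI) => //; apply: rowI_wedge.
Qed.

End NonZeroDivisor.

(** * Koszul homology of a minimal free resolution *)

Lemma sub_subZ (A : pzRingType) (V : lmodType A) (c : A) (x1 x2 t1 t2 : V) :
  x1 - c *: x2 - (t1 - c *: t2) = (x1 - t1) - c *: (x2 - t2).
Proof.
by rewrite scalerBr !opprB [c *: t2 - t1]addrC addrACA [- (c *: x2) + _]addrC.
Qed.

Section ResolutionHomology.
Context {K : fieldType} {n : nat}.
Hypothesis charK0 : [pchar K] =i pred0.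
Local Notation N := n.+1.
Local Notation R := {mpoly K[N]}.
Local Notation X := (fun i : 'I_N => 'X_i : R).
Local Notation kd := (kdiff X).
Context (I : R -> Prop) (HI : hideal I).
Context (sh : nat -> seq nat).
Context (df : forall i, 'M[R]_(size (sh i.+1), size (sh i))).

(** A minimal graded resolution, possibly infinite; it stops by [shift_nil] when
    there is a linear non-zero-divisor. *)
Record min_graded_complex : Prop := MinGradedComplex {
  mgc_shift0 : sh 0 = [:: 0%N];
  mgc_graded : forall i j l mon, mon \in msupp (df i j l) ->
    (mdeg mon + nth 0 (sh i) l = nth 0 (sh i.+1) j)%N;
  mgc_minimal : forall i j l, (df i j l)@_0%MM = 0;
  mgc_exact0 : forall f : R, I f <->
    exists w : 'rV[R]_(size (sh 1)), const_mx f = w *m df 0;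
  mgc_exact : forall i (v : 'rV[R]_(size (sh i.+1))), v *m df i = 0 <->
    exists w : 'rV[R]_(size (sh i.+2)), v = w *m df i.+1 }.

Hypothesis HF : min_graded_complex.

Local Notation F i := 'rV[R]_(size (sh i)).
Local Notation chain i := {ffun {set 'I_N} -> F i}.

Definition shf i (l : 'I_(size (sh i))) : nat := nth 0%N (sh i) l.

(** The quotient of F_i by its relations is the i-th syzygy module of R/I, with
    R/I itself for i = 0. *)
Definition relations i : F i -> Prop :=
  match i with
  | 0 => rowI I
  | i'.+1 => fun v => v *m df i' = 0
  end.

Lemma shift0_unique : exists o : 'I_(size (sh 0)), forall i, i = o.
Proof.
rewrite (mgc_shift0 HF) /=; exists ord0 => i; exact: ord1.
Qed.

Lemma relations_im i (v : F i) : relations v <-> exists w, v = w *m df i.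
Proof.
case: i v => [|i] v; last exact: mgc_exact.
have [o ho] := shift0_unique.
have -> : v = const_mx (v 0 o) by apply/rowP=> l; rewrite mxE (ho l).
rewrite -(mgc_exact0 HF); split=> [/(_ o)|Iv l]; by rewrite mxE.
Qed.

Lemma shf_graded i : graded_mx (@shf i) (@shf i.+1) (df i).
Proof. by move=> j l m; apply: (mgc_graded HF). Qed.

Lemma gsub_relations i : gsubmod (@shf i) (@relations i).
Proof. exact: (gsubmod_im (@shf_graded i) (@relations_im i)). Qed.

Lemma relations_const i (v : F i) l : relations v -> (v 0 l)@_0%MM = 0.
Proof.
move=> /relations_im[w ->]; rewrite mxE raddf_sum big1 // => j _ /=.
by rewrite rmorphM /= (mgc_minimal HF) mulr0.
Qed.

(** Composite of [i] connecting maps. It realises the isomorphism between the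
    Koszul homology in exterior degree [q + i] of R/I and that in exterior degree
    [q] of the i-th syzygy module, in every total degree [j]. *)
Fixpoint linked i q j : chain i -> chain 0 -> Prop :=
  match i with
  | 0 => fun w w0 => [/\ w = w0, chom (@shf 0) q j w & cycle_mod (@relations 0) w]
  | i'.+1 => fun w w0 => exists w1 : chain i',
      [/\ linked q.+1 j w1 w0, connected (df i') w1 w & chom (@shf i'.+1) q j w]
  end.

Lemma linked_hom i q j (w : chain i) w0 : linked q j w w0 ->
  [/\ chom (@shf i) q j w, cycle_mod (@relations i) w,
      chom (@shf 0) (q + i) j w0 & cycle_mod (@relations 0) w0].
Proof.
elim: i q w => [|i IH] q w /=; first by rewrite addn0 => -[<-].
move=> [w1 [/IH[h1 c1]]]; rewrite addSnnS => h0 c0 cn h; split=> //.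
exact: (connected_cycle' (fun v => iff_refl _) cn).
Qed.

Lemma linked_total i q j w0 :
  chom (@shf 0) (q + i) j w0 -> cycle_mod (@relations 0) w0 ->
  exists w : chain i, linked q j w w0.
Proof.
elim: i q => [|i IH] q /=; first by rewrite addn0 => h c; exists w0.
rewrite -addSnnS => h0 c0; have [w1 L] := IH _ h0 c0.
have [h1 c1 _ _] := linked_hom L.
have [w hw cn] := connected_lift (@shf_graded i) (@relations_im i) h1 c1.
by exists w, w1.
Qed.

Lemma linked_cototal i q j (w : chain i) :
  chom (@shf i) q j w -> cycle_mod (@relations i) w -> exists w0, linked q j w w0.
Proof.
elim: i q w => [|i IH] q w /= h c; first by exists w.
have [w1 h1 cn] := connected_colift (@shf_graded i) charK0 (@mgc_minimal HF i)
  (fun v => iff_refl _) h c.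
have [w0 L] := IH _ _ h1 (connected_cycle (@relations_im i) cn).
by exists w0, w1.
Qed.

Lemma linked_boundary i q j (w : chain i) w0 : linked q j w w0 ->
  boundary_mod (@relations i) w <-> boundary_mod (@relations 0) w0.
Proof.
elim: i q w => [|i IH] q w /=; first by case=> ->.
move=> [w1 [L cn h]]; have [h1 c1 _ _] := linked_hom L.
have ker v : relations v <-> v *m df i = 0 by [].
have E := connected_boundary (@shf_graded i) charK0 (@relations_im i) ker h1 h cn.
exact: iff_trans (iff_sym E) (IH _ _ L).
Qed.

Lemma linked_linear i q j (c : K) (w v : chain i) w0 v0 :
  linked q j w w0 -> linked q j v v0 ->
  linked q j (w - c%:MP *: v) (w0 - c%:MP *: v0).
Proof.
elim: i q w v => [|i IH] q w v /=.
  move=> [-> h1 c1] [-> h2 c2]; split=> //.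
    by apply: chomB => //; apply: chomZ.
  move=> S; rewrite kdiff_subZ chain_subE chain_scaleE.
  exact: (gsubB (gsub_relations 0) (c1 S) (gsubZ (gsub_relations 0) _ (c2 S))).
move=> [w1 [L1 cn1 h1]] [v1 [L2 cn2 h2]]; exists (w1 - c%:MP *: v1); split.
- exact: IH.
- by rewrite /connected kdiff_subZ cn1 cn2 chain_map_subZ.
- by apply: chomB => //; apply: chomZ.
Qed.

Lemma chom0_kdiff i j (w : chain i) : chom (@shf i) 0 j w -> kd w = 0.
Proof.
move=> h; apply/ffunP=> S; rewrite kdiffE big1 ?ffunE // => l lS.
by rewrite (chom_card h) ?scaler0 // cardsU1 lS.
Qed.

Lemma chom0_cycle i j (w : chain i) : chom (@shf i) 0 j w -> cycle_mod (@relations i) w.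
Proof.
by move=> h S; rewrite (chom0_kdiff h) ffunE; apply: (gsub0 (gsub_relations i)).
Qed.

(** In exterior degree 0 the homology of the i-th syzygy module is F_i modulo the
    maximal ideal, because the relations have no constant terms. *)
Lemma boundary_const i j (w : chain i) : chom (@shf i) 0 j w ->
  boundary_mod (@relations i) w <-> (forall l, (w set0 0 l)@_0%MM = 0).
Proof.
move=> h; split=> [[u Qu] l|w0].
  have := relations_const l (Qu set0); rewrite !mxE mcoeffB => /eqP; rewrite subr_eq0 => /eqP ->.
  rewrite kdiffE summxE raddf_sum big1 // => m _ /=.
  rewrite mxE !rmorphM /= mcoeffX.
  by case: eqP => [/(congr1 mdeg)|_]; rewrite ?mul0r // mdeg1 mdeg0.
have [u _ <-] := koszul_exact charK0 h (chom0_kdiff h) (fun l _ => w0 l).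
by exists u => S; rewrite subrr; apply: (gsub0 (gsub_relations i)).
Qed.

Definition basis_chain i (l : 'I_(size (sh i))) : chain i :=
  [ffun S : {set 'I_N} => if S == set0 then delta_mx 0 l else 0].

Lemma basis_chain_hom i l : chom (@shf i) 0 (shf l) (basis_chain l).
Proof.
apply/chomP=> S l' m; rewrite ffunE; case: (S =P set0) => [->|_]; last by rewrite mxE msupp0.
rewrite mxE eqxx /=; case: (l' =P l) => [->|_]; last by rewrite msupp0.
by rewrite msupp1 inE => /eqP ->; rewrite cards0 mdeg0 addn0.
Qed.

Lemma basis_chain_const i (l l' : 'I_(size (sh i))) :
  (basis_chain l set0 0 l')@_0%MM = (l' == l)%:R.
Proof.
by rewrite ffunE eqxx mxE eqxx /=; case: eqP => _; rewrite ?mcoeff1 ?mcoeff0 ?eqxx.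
Qed.

(** A generator of F_i is a non-zero class in Koszul homology of R/I; the position
    and degree of that homology then constrain the shifts of F_i. *)
Lemma basis_chain_linked i (l : 'I_(size (sh i))) :
  exists2 w0, linked 0 (shf l) (basis_chain l) w0 & ~ boundary_mod (@relations 0) w0.
Proof.
have h := basis_chain_hom l; have [w0 L] := linked_cototal h (chom0_cycle h).
exists w0 => // /(linked_boundary L)/(boundary_const h)/(_ l).
rewrite basis_chain_const eqxx => /eqP; by rewrite oner_eq0.
Qed.

Lemma shift_ge i (l : 'I_(size (sh i))) : (i <= shf l)%N.
Proof.
have [w0 L nb] := basis_chain_linked l; have [_ _ h0 _] := linked_hom L.
rewrite leqNgt; apply/negP=> lt; case: nb; exists 0 => S.
rewrite raddf0 chain0E subr0; have -> : w0 = 0.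
  apply/ffunP=> T; apply/rowP=> o; apply/eqP; rewrite !ffunE mxE -msupp_eq0.
  case E: (msupp _) => [//|m s].
  have /((chomP _ _ _ _).1 h0)[_] : m \in msupp (w0 T 0 o) by rewrite E mem_head.
  by rewrite add0n; lia.
rewrite ffunE; exact: (gsub0 (gsub_relations 0)).
Qed.

Lemma shf0 (l : 'I_(size (sh 0))) : shf l = 0%N.
Proof.
by have := shift0_unique; rewrite /shf; move: l; rewrite (mgc_shift0 HF) /= => l; rewrite ord1.
Qed.

Lemma chom_sh0 q j (w : chain 0) : chom (@shf 0) q j w <-> chom (@sh0 _) q j w.
Proof.
by split=> /chomP h; apply/chomP=> S l m /h; rewrite /sh0 shf0.
Qed.

Context (b : 'I_N -> K).
Hypothesis nzd : forall f, I (lform b * f) -> I f.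
Local Notation J := (plus_l I b).

(** Homogeneous elements of degree [e] representing socle elements of
    R/(I + (l)). *)
Definition socle e (g : R) : Prop := g \is e.-homog /\ forall i, J ('X_i * g).

(** Koszul homology of R/I in exterior degree [i] stops at total degree [D + i]. *)
Lemma shift_le D i (l : 'I_(size (sh i))) :
  (forall e f, (D < e)%N -> f \is e.-homog -> J f) -> (shf l <= D + i)%N.
Proof.
move=> HD; rewrite leqNgt; apply/negP=> lt.
have [w0 L []] := basis_chain_linked l; have [_ _ h0 c0] := linked_hom L.
exact: (cycle_bound HI nzd HD ((chom_sh0 _ _ _).1 h0) c0 lt).
Qed.

(** Since R/I has a linear non-zero-divisor, its Koszul homology vanishes in
    exterior degree above [n]. *)
Lemma shift_nil i : (n < i)%N -> sh i = [::].
Proof.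
move=> ni; case E: (size (sh i)) => [|s]; first exact: size0nil.
have l : 'I_(size (sh i)) by rewrite E; exact: ord0.
have [w0 L []] := basis_chain_linked l; have [_ _ h0 c0] := linked_hom L.
exists 0 => S; rewrite raddf0 chain0E subr0.
exact: (cycle_vanish HI nzd ni ((chom_sh0 _ _ _).1 h0) c0).
Qed.

Let HJ := plus_l_hideal HI b.

(** From here on the generators of F_n are compared with the socle of R/(I + (l)):
    both compute Koszul homology of R/I in exterior degree [n]. *)
Lemma linked_top e (w : chain n) w0 : linked 0 e w w0 ->
  rowI J (top_part b w0) <-> boundary_mod (@relations n) w.
Proof.
move=> L; have [_ _ h0 c0] := linked_hom L.
rewrite (linked_boundary L).
exact: (top_part_boundary HI nzd ((chom_sh0 _ _ _).1 h0) c0 erefl).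
Qed.

Lemma socle_linked e g : socle e g -> exists w w0,
  linked 0 (e + n) (w : chain n) w0 /\ rowI J (const_mx g - top_part b w0).
Proof.
move=> [hg sg].
have [||w0 [h0 c0 top]] := @socle_lift _ _ _ HI b nzd _ e (const_mx g : F 0).
- by move=> i; rewrite mxE.
- by move=> i l; rewrite !mxE.
have [w L] := @linked_total n 0 _ w0 ((chom_sh0 _ _ _).2 h0) c0.
by exists w, w0; split=> // l; apply: plus_lI; apply: top.
Qed.

Lemma const_rowJ g : rowI J (const_mx g : F 0) <-> J g.
Proof.
have [o _] := shift0_unique; split=> [/(_ o)|Jg l]; by rewrite mxE.
Qed.

Lemma rowJ_sub (u v : F 0) : rowI J (u - v) -> rowI J u <-> rowI J v.
Proof.
have G := rowI_gsubmod HJ (size (sh 0)).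
move=> Juv; split=> H.
  by rewrite -[v](subKr u); apply: (gsubB G).
by rewrite -[u](subrK v); apply: (gsubD G).
Qed.

Lemma socle_shift e g : socle e g -> ~ J g -> (e + n)%N \in sh n.
Proof.
move=> sg nJ; have [w [w0 [L top]]] := socle_linked sg.
have [h _ _ _] := linked_hom L.
have [l nz] : exists l, (w set0 0 l)@_0%MM <> 0.
  apply: not_all_ex_not => H; apply/nJ/const_rowJ/(rowJ_sub top).
  by apply/(linked_top L)/(boundary_const h).
have /((chomP _ _ _ _).1 h)[_] : 0%MM \in msupp (w set0 0 l).
  by rewrite mcoeff_msupp; apply/eqP.
rewrite mdeg0 add0n addn0 => <-; exact: mem_nth.
Qed.

Lemma top_part_linear (c : K) (w v : chain 0) :
  top_part b (w - c%:MP *: v) = top_part b w - c%:MP *: top_part b v.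
Proof. by rewrite /top_part /wedge_l wedge_form_subZ chain_subE chain_scaleE. Qed.

Lemma socle_dim1 e g1 g2 : size (sh n) = 1%N ->
  socle e g1 -> socle e g2 -> ~ J g2 -> exists c : K, J (g1 - c%:MP * g2).
Proof.
move=> sz s1 s2 nJ; have G := rowI_gsubmod HJ (size (sh 0)).
have [w1 [w01 [L1 T1]]] := socle_linked s1.
have [w2 [w02 [L2 T2]]] := socle_linked s2.
have [h1 _ _ _] := linked_hom L1; have [h2 _ _ _] := linked_hom L2.
have [l nz] : exists l, (w2 set0 0 l)@_0%MM <> 0.
  apply: not_all_ex_not => H; apply/nJ/const_rowJ/(rowJ_sub T2).
  by apply/(linked_top L2)/(boundary_const h2).
pose c := (w1 set0 0 l)@_0%MM / (w2 set0 0 l)@_0%MM.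
exists c; apply/const_rowJ.
have -> : const_mx (g1 - c%:MP * g2) = const_mx g1 - c%:MP *: const_mx g2 :> F 0.
  by apply/rowP=> i; rewrite !mxE.
have L := linked_linear c L1 L2; have [h _ _ _] := linked_hom L.
apply/(@rowJ_sub _ (top_part b (w01 - c%:MP *: w02))).
  rewrite top_part_linear sub_subZ.
  by apply: (gsubB G) => //; apply: (gsubZ G).
apply/(linked_top L)/(boundary_const h) => l'.
have -> : l' = l by move: l l' {nz c L h} ; rewrite sz => l l'; rewrite !ord1.
rewrite chain_subE chain_scaleE !mxE mcoeffB mcoeffCM /c divfK ?subrr //.
exact/eqP.
Qed.

Lemma shift_socle (l : 'I_(size (sh n))) : (n <= shf l)%N /\
  exists w0, [/\ linked 0 (shf l) (basis_chain l) w0 &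
    exists g, [/\ socle (shf l - n) g, ~ J g & rowI J (const_mx g - top_part b w0)]].
Proof.
split; first exact: shift_ge.
have [w0 L nb] := basis_chain_linked l; have [_ _ h0 c0] := linked_hom L.
exists w0; split=> //; have [o ho] := shift0_unique.
have tE : const_mx (top_part b w0 0 o) = top_part b w0.
  by apply/rowP=> i; rewrite mxE (ho i).
exists (top_part b w0 0 o); rewrite tE subrr; split.
- split; first by apply: wedge_homog; apply/chom_sh0; exact: h0.
  move=> i; have := top_part_socle HI b i c0 => /(_ o); by rewrite mxE.
- by rewrite -const_rowJ tE (linked_top L) (linked_boundary L).
- by move=> i; rewrite mxE; apply: (hid0 HJ).
Qed.

Lemma shifts_le1 r :
  (forall e g, socle e g -> e <> r -> J g) ->
  (forall g1 g2, socle r g1 -> socle r g2 -> ~ J g2 -> exists c : K, J (g1 - c%:MP * g2)) ->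
  (size (sh n) <= 1)%N.
Proof.
move=> Hdeg Hdim; rewrite leqNgt; apply/negP=> sz.
have G := rowI_gsubmod HJ (size (sh 0)).
pose l1 : 'I_(size (sh n)) := Ordinal (ltnW sz); pose l2 := Ordinal sz.
have [n1 [w01 [L1 [g1 [s1 nJ1 T1]]]]] := shift_socle l1.
have [n2 [w02 [L2 [g2 [s2 nJ2 T2]]]]] := shift_socle l2.
have e1 : (shf l1 - n = r)%N by apply: NNPP => ne; exact: (nJ1 (Hdeg _ _ s1 ne)).
have e2 : (shf l2 - n = r)%N by apply: NNPP => ne; exact: (nJ2 (Hdeg _ _ s2 ne)).
have e12 : shf l1 = shf l2 by lia.
rewrite e1 in s1; rewrite e2 in s2; have [c Jc] := Hdim _ _ s1 s2 nJ2.
rewrite e12 in L1.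
have L := linked_linear c L1 L2; have [h _ _ _] := linked_hom L.
have : rowI J (top_part b (w01 - c%:MP *: w02)).
  apply/(@rowJ_sub (const_mx (g1 - c%:MP * g2))); last exact/const_rowJ.
  have -> : const_mx (g1 - c%:MP * g2) = const_mx g1 - c%:MP *: const_mx g2 :> F 0.
    by apply/rowP=> i; rewrite !mxE.
  rewrite top_part_linear sub_subZ.
  by apply: (gsubB G) => //; apply: (gsubZ G).
move/(linked_top L)/(boundary_const h)/(_ l1)/eqP.
rewrite chain_subE chain_scaleE !mxE mcoeffB mcoeffCM.
rewrite !basis_chain_const eqxx.
have -> : (l1 == l2) = false by apply/eqP => /(congr1 val).
by rewrite mulr0 subr0 oner_eq0.
Qed.

End ResolutionHomology.

(** * Existence of minimal graded free resolutions *)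

Section FiniteSpan.
Context {K : fieldType}.

(** A subspace contained in [P] that misses an element of [P] can be enlarged, and
    the dimension of [vT] bounds how often. *)
Lemma subspace_vspace (vT : vectType K) (P : vT -> Prop) :
  P 0 -> (forall (c : K) u v, P u -> P v -> P (c *: u + v)) ->
  exists U : {vspace vT}, forall v, v \in U <-> P v.
Proof.
move=> P0 PL.
have H d : forall U : {vspace vT}, (forall v, v \in U -> P v) ->
    (\dim (fullv : {vspace vT}) - \dim U <= d)%N ->
    exists U' : {vspace vT}, forall v, v \in U' <-> P v.
  elim: d => [|d IH] U HU dU.
    have Uf : U = fullv.
      by apply/eqP; rewrite eqEdim subvf -subn_eq0 -leqn0.
    exists U => v; split=> [|_]; [exact: HU | by rewrite Uf memvf].
  have [sub|/not_all_ex_not[v Hv]] := classic (forall v, P v -> v \in U).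
    by exists U => v; split; [exact: HU | exact: sub].
  have [Pv vU] : P v /\ ~ v \in U by split; [apply: NNPP => nP | move=> vU]; apply: Hv.
  apply: (IH (U + <[v]>)%VS).
    by move=> _ /memv_addP[u uU [_ /vlineP[c ->] ->]]; rewrite addrC; apply: PL => //; exact: HU.
  have : (\dim U < \dim (U + <[v]>))%N.
    rewrite ltn_neqAle dimvS ?addvSl // andbT; apply/negP => /eqP e.
    have /eqP UE : U == (U + <[v]>)%VS by rewrite eqEdim addvSl e leqnn.
    by apply: vU; rewrite UE; apply: (subvP (addvSr _ _)); exact: memv_line.
  by move: dU; lia.
apply: (H (\dim (fullv : {vspace vT})) 0%VS); last by rewrite leq_subr.
by move=> v; rewrite memv0 => /eqP ->.
Qed.

End FiniteSpan.

Lemma mulmx_row' (A : nzRingType) k' k (i0 : 'I_k'.+1) (u : 'rV[A]_k'.+1)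
    (phi : 'M[A]_(k'.+1, k)) : u *m phi =
  u 0 i0 *: row i0 phi + \sum_j u 0 (lift i0 j) *: row j (row' i0 phi).
Proof.
rewrite mulmx_sum_row (bigD1_ord i0) //; congr (_ + _).
by apply: eq_bigr => j _; congr (_ *: _); apply/rowP=> l; rewrite !mxE.
Qed.

Lemma ex_least (P : nat -> Prop) : (exists m, P m) ->
  exists m, P m /\ forall m', (m' < m)%N -> ~ P m'.
Proof.
move=> [m]; elim/ltn_ind: m => m IH Pm.
have [[m' [lt Pm']]|H] := classic (exists m', (m' < m)%N /\ P m'); first exact: IH Pm'.
by exists m; split=> // m' lt Pm'; apply: H; exists m'.
Qed.

Section Generators.
Context {K : fieldType} {N k : nat}.
Hypothesis charK0 : [pchar K] =i pred0.
Context (sh : 'I_k -> nat).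
Local Notation R := {mpoly K[N]}.
Local Notation M := 'rV[R]_k.
Local Notation chain := {ffun {set 'I_N} -> M}.
Local Notation X := (fun i : 'I_N => 'X_i : R).
Local Notation kd := (kdiff X).

(** What makes Q finitely and minimally generated: it is graded, lies in the
    maximal ideal times M, and M/Q has Koszul homology in bounded degrees only.
    The last property passes to the next syzygy module, so that the construction
    of a resolution can go on. *)
Record bounded_sub (Q : M -> Prop) : Prop := BoundedSub {
  bs_sub : gsubmod sh Q;
  bs_const : forall v l, Q v -> (v 0 l)@_0%MM = 0;
  bs_bound : exists D, forall q j (w : chain), chom sh q.+1 j w -> cycle_mod Q w ->
    (D + q < j)%N -> boundary_mod Q w }.

Definition vhom j (v : M) := vpart sh 0 j v = v.

Lemma vhomP j v : vhom j v <-> forall l m, m \in msupp (v 0 l) -> (mdeg m + sh l = j)%N.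
Proof.
split=> [/rowP H l m|H].
  by have := H l; rewrite mxE addn0 => /hpartP; apply.
by apply/rowP=> l; rewrite mxE addn0; apply/hpartP; apply: H.
Qed.

Lemma vpart_sum (v : M) : exists B, v = \sum_(j < B) vpart sh 0 j v.
Proof.
(* crude common bound for the degrees of all coordinates *)
pose B := (\sum_l (msize (v ord0 l) + sh l)%N).+1.
exists B; apply/rowP=> l; rewrite summxE.
under eq_bigr => j _ do rewrite mxE addn0.
apply: hpart_sum => m /msize_mdeg_lt lt.
have : (msize (v ord0 l) + sh l < B)%N.
  by rewrite ltnS (bigD1 l) //= leq_addr.
by apply: leq_ltn_trans; rewrite leq_add2r ltnW.
Qed.

Context (Q : M -> Prop) (HQ : bounded_sub Q).
Let GQ := bs_sub HQ.

(** As [v] has no constant terms it is d w for a 1-chain w, which is a cycle modulo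
    Q. Above the bound w = d u + k with k valued in Q, so v = d k lies in the
    maximal ideal times Q. *)
Lemma high_degree_decomposable : exists D, forall j v, (D < j)%N -> Q v -> vhom j v ->
  exists g : 'I_N -> M, (forall i, Q (g i)) /\ v = \sum_i 'X_i *: g i.
Proof.
have [D HD] := bs_bound HQ; exists D => j v Dj Qv hv.
(* v as a chain of exterior degree 0 *)
pose f : chain := [ffun S : {set 'I_N} => if S == set0 then v else 0].
have hf : chom sh 0 j f.
  apply/chomP=> S l m; rewrite ffunE; case: (S =P set0) => [->|_]; last by rewrite mxE msupp0.
  by move=> /(((vhomP _ _).1 hv) l) <-; rewrite cards0 addn0.
have f0 : f set0 = v by rewrite ffunE eqxx.
have [|l _|w hw e] := koszul_exact charK0 hf.
- apply/ffunP=> S; rewrite kdiffE chain0E big1 // => i iS.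
  by rewrite (chom_card hf) ?scaler0 // cardsU1 iS.
- by rewrite f0; exact: (bs_const HQ l Qv).
have [||u Qu] := HD 0%N j w hw; first 2 last.
- exists (fun i => (w - kd u) [set i]); split; first by move=> i; rewrite chain_subE.
  rewrite -f0 -e -[kd w in LHS]subr0 -(kdiff_sq X u) -raddfB /= kdiffE.
  rewrite big_mkcond; apply: eq_bigr => i _; rewrite inE setU0 /=.
  by rewrite /ksign (eq_card0 (A := [set _ in _ | _])) ?mulr1 // => t; rewrite !inE.
- move=> S; rewrite e ffunE; case: ifP => // _; exact: (gsub0 GQ).
- by rewrite addn0.
Qed.

Definition generates k' (sh' : 'I_k' -> nat) (phi : 'M[R]_(k', k)) : Prop :=
  graded_mx sh sh' phi /\ (forall v, Q v <-> exists w, v = w *m phi).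

Lemma vpartZ c j (a : K) (v : M) : vpart sh c j (a%:MP *: v) = a%:MP *: vpart sh c j v.
Proof. by apply/rowP=> l; rewrite !mxE !mul_mpolyC linearZ. Qed.

Lemma vpartX j (i : 'I_N) (v : M) : vpart sh 0 j.+1 ('X_i *: v) = 'X_i *: vpart sh 0 j v.
Proof.
apply/rowP=> l; rewrite !mxE mulrC (@hpartM _ _ (sh l + 1) _ _ _ 'X_i) => [|m].
  by rewrite addn0 -[j.+1]addn1 hpart_addS mulrC.
by rewrite msuppX inE => /eqP ->; rewrite mdeg1 addn0 addnC.
Qed.

Lemma vpart_vhom j (v : M) : vhom j (vpart sh 0 j v).
Proof. by apply/rowP=> l; rewrite !mxE hpart_id. Qed.

(** Elements of high degree are decomposable, so Q is generated by its elements of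
    degree at most D, and these live in a finite-dimensional space. *)
Lemma finite_generators : exists k' (sh' : 'I_k' -> nat) phi, @generates k' sh' phi.
Proof.
have [D HD] := high_degree_decomposable.
pose vT := {ffun 'I_k * 'X_{1..N < D.+1} -> K^o}.
pose unf (t : vT) : M := \row_l \sum_m t (l, m) *: 'X_[m].
have unfD c s t : unf (c *: s + t) = c%:MP *: unf s + unf t.
  apply/rowP=> l; rewrite !mxE mulr_sumr -big_split; apply: eq_bigr => m _.
  by rewrite !ffunE scalerDl mul_mpolyC scalerA.
have unf0 : unf 0 = 0.
  by apply/rowP=> l; rewrite !mxE big1 // => m _; rewrite ffunE scale0r.
have [||U HU] := @subspace_vspace K vT (fun t => Q (unf t)).
- by rewrite unf0; apply: (gsub0 GQ).
- by move=> c u v Qu Qv; rewrite unfD; apply: (gsubD GQ) => //; apply: (gsubZ GQ).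
pose I : finType := ('I_D.+1 * 'I_(\dim U))%type.
(* basis vectors need not be homogeneous; all their parts are taken *)
pose G (p : I) := vpart sh 0 p.1 (unf (vbasis U)`_p.2).
pose phi : 'M[R]_(#|I|, k) := \matrix_i G (enum_val i).
have QG p : Q (G p).
  apply: (gsub_part GQ); apply/HU/vbasis_mem/mem_nth.
  by rewrite size_tuple.
exists #|I|, (fun i => (enum_val i : I).1 : nat), phi; split.
  move=> i l m; rewrite !mxE addn0 => mS.
  exact: ((hpartP _ _ _).1 (hpart_id _ _ _) _ mS).
pose Sp (v : M) := exists w, v = w *m phi.
have Sp0 : Sp 0 by exists 0; rewrite mul0mx.
have SpD u v : Sp u -> Sp v -> Sp (u + v).
  by move=> [u' ->] [v' ->]; exists (u' + v'); rewrite mulmxDl.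
have SpZ p u : Sp u -> Sp (p *: u).
  by move=> [u' ->]; exists (p *: u'); rewrite -scalemxAl.
have Sp_sum (J : finType) (F : J -> M) : (forall i, Sp (F i)) -> Sp (\sum_i F i).
  by move=> H; elim/big_ind: _.
have SpG p : Sp (G p).
  exists (delta_mx 0 (enum_rank p)); rewrite -rowE.
  by apply/rowP=> l; rewrite !mxE enum_rankK.
have Sp_low j v : (j <= D)%N -> Q v -> vhom j v -> Sp v.
  move=> jD Qv hv; pose t : vT := [ffun p : 'I_k * 'X_{1..N < D.+1} => (v 0 p.1)@_(bmnm p.2)].
  have unft : unf t = v.
    apply/rowP=> l; rewrite mxE [RHS](@mpolywE _ _ D.+1).
      by apply: eq_bigr => m _; rewrite ffunE.
    rewrite msizeE; apply/bigmax_leqP_seq => m mS _.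
    by have := ((vhomP _ _).1 hv) _ _ mS; lia.
  have tU : t \in U by apply/HU; rewrite unft.
  rewrite -hv -unft (coord_vbasis tU).
  have -> (c : 'I_(\dim U) -> K) : unf (\sum_i c i *: (vbasis U)`_i) =
      \sum_i (c i)%:MP *: unf (vbasis U)`_i.
    elim/big_ind2: _ => // [x1 x2 y1 y2 <- <-|i _].
      by have := unfD 1 x2 y2; rewrite scale1r => ->; rewrite mpolyC1 scale1r.
    by have := unfD (c i) (vbasis U)`_i 0; rewrite unf0 !addr0.
  rewrite raddf_sum; apply: Sp_sum => i /=; rewrite vpartZ; apply: SpZ.
  have jD' : (j < D.+1)%N by [].
  exact: (SpG (Ordinal jD', i)).
have Sp_hom j v : Q v -> vhom j v -> Sp v.
  elim: j v => [|j IH] v Qv hv; first exact: (Sp_low 0%N).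
  have [jD|jD] := leqP j.+1 D; first exact: (Sp_low j.+1).
  have [g [Qg e]] := HD _ _ jD Qv hv.
  rewrite -hv e raddf_sum; apply: Sp_sum => i /=; rewrite vpartX; apply: SpZ.
  by apply: IH; [apply: (gsub_part GQ) | exact: vpart_vhom].
move=> v; split=> [Qv|[w ->]].
  have [B ->] := vpart_sum v; apply: Sp_sum => j.
  by apply: (Sp_hom j); [apply: (gsub_part GQ) | exact: vpart_vhom].
rewrite mulmx_sum_row; apply: (gsub_sum _ GQ) => i _; apply: (gsubZ GQ).
by have -> : row i phi = G (enum_val i) by apply/rowP=> l; rewrite !mxE.
Qed.

(** In a generating family of least size no generator is a combination of the
    others; a relation with a non-zero constant coefficient would make one so,
    once it is replaced by its part in the degree of that generator. *)
Lemma minimal_generators : exists k' (sh' : 'I_k' -> nat) phi,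
  @generates k' sh' phi /\
  forall w : 'rV_k', w *m phi = 0 -> forall i, (w 0 i)@_0%MM = 0.
Proof.
have [k' [[sh' [phi [phiG im]]] least]] := ex_least finite_generators.
exists k', sh', phi; split=> // w w0 i0; apply/eqP/negP => /negP c0.
case: k' => [|k'] in sh' phi phiG im least w w0 i0 c0 *; first by case: i0 c0.
apply: (least k') => //.
set c := (w 0 i0)@_0%MM in c0.
(* the part of the relation in the degree of generator i0, whose coefficient
   at i0 is then constant *)
pose w' := vpart sh' 0 (sh' i0) w.
have w'0 : w' *m phi = 0 by rewrite -(vpart_mulmx phiG) w0 raddf0.
have w'i0 : w' 0 i0 = c%:MP.
  apply/mpolyP=> m; rewrite mxE mcoeff_hpart addn0 mcoeffC -{2}[sh' i0]add0n eqn_add2r.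
  by rewrite mdeg_eq0; case: eqP => [->|_]; rewrite ?mulr1 ?mulr0.
clearbody w'.
exists (fun j => sh' (lift i0 j)), (row' i0 phi); split.
  by move=> i l m; rewrite mxE; apply: phiG.
have split_row u := mulmx_row' i0 u phi.
have row0 : row i0 phi =
    - (c^-1%:MP *: \sum_j w' 0 (lift i0 j) *: row j (row' i0 phi)).
  have := w'0; rewrite split_row w'i0 => /eqP; rewrite addr_eq0 => /eqP.
  move/(congr1 (fun v => c^-1%:MP *: v)); rewrite scalerA -mpolyCM mulVf // scale1r => ->.
  by rewrite scalerN.
move=> v; rewrite im; split=> -[u ->].
  exists (\row_j (u 0 (lift i0 j) - u 0 i0 * c^-1%:MP * w' 0 (lift i0 j))).
  rewrite split_row row0 mulmx_sum_row scalerN scalerA scaler_sumr addrC -sumrB.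
  by apply: eq_bigr => j _; rewrite mxE scalerBl !scalerA.
exists (\row_i if unlift i0 i is Some j then u 0 j else 0).
rewrite split_row mxE unlift_none scale0r add0r mulmx_sum_row.
by apply: eq_bigr => j _; rewrite mxE liftK.
Qed.

End Generators.

Section Existence.
Context {K : fieldType} {N : nat}.
Hypothesis charK0 : [pchar K] =i pred0.
Local Notation R := {mpoly K[N]}.

Definition nthsh (s : seq nat) (l : 'I_(size s)) : nat := nth 0%N s l.

(** A stage of the resolution: the twists of a free module together with the
    submodule of relations that the next stage has to generate. *)
Record stage := Stage {
  st_sh : seq nat;
  st_sub : 'rV[R]_(size st_sh) -> Prop;
  st_bounded : bounded_sub (@nthsh st_sh) st_sub }.

Lemma next_stage (st : stage) : exists (st' : stage)
    (phi : 'M[R]_(size (st_sh st'), size (st_sh st))),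
  [/\ graded_mx (@nthsh (st_sh st)) (@nthsh (st_sh st')) phi,
      forall i l, (phi i l)@_0%MM = 0,
      forall v, st_sub v <-> exists w, v = w *m phi &
      forall w, st_sub w <-> w *m phi = 0].
Proof.
case: st => s Q HQ /=.
have [k' [sh' [phi0 [[phi0G im0] min0]]]] := minimal_generators charK0 HQ.
pose s' := [seq sh' i | i <- enum 'I_k'].
have ss' : size s' = k' by rewrite size_map size_enum_ord.
pose phi : 'M[R]_(size s', size s) := castmx (esym ss', erefl) phi0.
have shE i : nthsh i = sh' (cast_ord ss' i).
  have lt : (i < size (enum 'I_k'))%N by rewrite size_enum_ord -ss'.
  have o : 'I_k' by exact: cast_ord ss' i.
  rewrite /nthsh (nth_map o) //; congr sh'; apply/val_inj => /=.
  by rewrite nth_enum_ord // -ss'.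
have phiE i l : phi i l = phi0 (cast_ord ss' i) l.
  by rewrite castmxE /= esymK cast_ord_id.
have mulE (w : 'rV_(size s')) : w *m phi = castmx (erefl, ss') w *m phi0.
  apply/rowP=> l; rewrite !mxE (reindex (cast_ord ss')) /=; last first.
    by exists (cast_ord (esym ss')) => i _; rewrite ?cast_ordK ?cast_ordKV.
  apply: eq_bigr => i _; rewrite phiE castmxE /= cast_ord_id; congr (w _ _ * _).
  by apply: val_inj.
have phiG : graded_mx (@nthsh s) (@nthsh s') phi.
  by move=> i l m; rewrite phiE shE; apply: phi0G.
have im v : Q v <-> exists w, v = w *m phi.
  rewrite im0; split=> -[w ->].
    by exists (castmx (erefl, esym ss') w); rewrite mulE castmx_comp /= castmx_id.
  by exists (castmx (erefl, ss') w); rewrite mulE.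
have phi_min i l : (phi i l)@_0%MM = 0.
  have := bs_const HQ (v := row i phi) l; rewrite mxE; apply.
  by apply/im; exists (delta_mx 0 i); rewrite rowE.
pose Q' (w : 'rV[R]_(size s')) := w *m phi = 0.
have ker w : Q' w <-> w *m phi = 0 by [].
have bQ : bounded_sub (@nthsh s') Q'.
  split.
  - exact: (gsubmod_ker phiG ker).
  - move=> w l; rewrite /Q' mulE => /min0/(_ (cast_ord ss' l)).
    by rewrite castmxE /= cast_ord_id cast_ord_comp cast_ord_id.
  - have [D HD] := bs_bound HQ; exists D.+1 => q j w' hw' cw' lt.
    have [w hw cn] := connected_colift phiG charK0 phi_min ker hw' cw'.
    apply/(connected_boundary phiG charK0 im ker hw hw' cn).
    apply: (HD q.+1 j) => //; first exact: (connected_cycle im cn).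
    by lia.
by exists (Stage bQ), phi; split.
Qed.

Definition next (st : stage) :
  {st' : stage & 'M[R]_(size (st_sh st'), size (st_sh st))} :=
  let: exist st' H := constructive_indefinite_description _ (next_stage st) in
  let: exist phi _ := constructive_indefinite_description _ H in existT _ st' phi.

Lemma nextP (st : stage) (st' := projT1 (next st)) (phi := projT2 (next st)) :
  [/\ graded_mx (@nthsh (st_sh st)) (@nthsh (st_sh st')) phi,
      forall i l, (phi i l)@_0%MM = 0,
      forall v, st_sub v <-> exists w, v = w *m phi &
      forall w, st_sub w <-> w *m phi = 0].
Proof.
rewrite /phi /st' /next {phi st'}; case: constructive_indefinite_description => st' H.
by case: constructive_indefinite_description.
Qed.

Fixpoint stages (st : stage) (i : nat) : stage :=
  if i is i'.+1 then projT1 (next (stages st i')) else st.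

End Existence.

Section ExistsComplex.
Context {K : fieldType} {n : nat}.
Hypothesis charK0 : [pchar K] =i pred0.
Local Notation N := n.+1.
Local Notation R := {mpoly K[N]}.
Context (I : R -> Prop) (HI : hideal I) (b : 'I_N -> K) (D : nat).
Hypothesis nzd : forall f, I (lform b * f) -> I f.
Hypothesis bound : forall e f, (D < e)%N -> f \is e.-homog -> plus_l I b f.
Hypothesis proper : forall f, I f -> f@_0%MM = 0.

(** Minimal presentations are iterated, starting with R modulo I; the bound for
    the first stage is that of [cycle_bound]. *)
Lemma exists_min_graded_complex : exists sh df, @min_graded_complex K n I sh df.
Proof.
have b0 : bounded_sub (@nthsh [:: 0%N]) (@rowI _ _ 1 I).
  have shE (l : 'I_1) : @nthsh [:: 0%N] l = 0%N by rewrite ord1.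
  have hE q j w : chom (@nthsh [:: 0%N]) q j w <-> chom (@sh0 1) q j w.
    by split=> /chomP h; apply/chomP=> S l m /h; rewrite shE.
  split.
  - have [g0 gD gZ gH] := rowI_gsubmod HI 1; split=> // c j u Qu.
    have -> : vpart (@nthsh [:: 0%N]) c j u = vpart (@sh0 1) c j u.
      by apply/rowP=> l; rewrite !mxE shE.
    exact: gH.
  - by move=> v l /(_ l)/proper.
  - exists D.+1 => q j w /hE hw cw lt.
    by apply: (cycle_bound HI nzd bound hw cw); lia.
pose st := stages charK0 (Stage b0).
exists (fun i => st_sh (st i)), (fun i => projT2 (next charK0 (st i))).
have P i := nextP charK0 (st i).
split=> //.
- by move=> i j l m mS; case: (P i) => G _ _ _; apply: (G _ _ _ mS).
- by move=> i j l; case: (P i).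
- move=> f; case: (P 0%N) => _ _ im _; rewrite -im /=.
  by split=> [If l|/(_ ord0)]; rewrite mxE.
- move=> i v; case: (P i) => _ _ _ ker; case: (P i.+1) => _ _ im _.
  by rewrite -im -ker.
Qed.

End ExistsComplex.

(** * Ideals of points and apolarity *)

Section BigSums.
Context {K : fieldType} {N : nat} (T : Type) (r : seq T) (P : pred T).
Local Notation R := {mpoly K[N]}.

Lemma pihomog_sum d (F : T -> R) :
  pihomog mdeg d (\sum_(i <- r | P i) F i) = \sum_(i <- r | P i) pihomog mdeg d (F i).
Proof. exact: (raddf_sum (pihomog mdeg d : {linear R -> R})). Qed.

Lemma pihomogZ d (c : K) (p : R) : pihomog mdeg d (c *: p) = c *: pihomog mdeg d p.
Proof. exact: (linearZ_LR (pihomog mdeg d : {linear R -> R})). Qed.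

Lemma meval_sum (v : 'I_N -> K) (F : T -> R) :
  (\sum_(i <- r | P i) F i).@[v] = \sum_(i <- r | P i) (F i).@[v].
Proof. exact: (raddf_sum (meval v : {additive R -> K})). Qed.

End BigSums.

Section Points.
Context {K : fieldType} {n m : nat} (a : 'I_m -> 'I_n.+1 -> K).
Local Notation N := n.+1.
Local Notation R := {mpoly K[N]}.
Local Notation I := (vanishing_ideal a).

Lemma pihomog_hpart d (p : R) : pihomog mdeg d p = hpart 0 d p.
Proof. by rewrite /hpart subn0. Qed.

Lemma pihomogM_homog e d (u g : R) : g \is e.-homog ->
  pihomog mdeg d (u * g) = hpart e d u * g.
Proof.
move=> hg; rewrite pihomog_hpart; apply: hpartM => mon /(dhomog_mf hg) /= ->.
by rewrite addn0.
Qed.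

(** The generators are homogeneous, so membership is tested on homogeneous parts. *)
Lemma vanishing_idealP f :
  I f <-> forall d i, (pihomog mdeg d f).@[a i] = 0.
Proof.
split=> [[k [u [g [Hg ->]]]] d i|H].
  rewrite pihomog_sum meval_sum big1 // => l _.
  have [/homogP[e he] g0] := Hg l.
  by rewrite (pihomogM_homog _ _ he) mevalM g0 mulr0.
exists (msize f), (fun=> 1), (fun d => pihomog mdeg d f); split.
  by move=> d; split; [apply: homogE (pihomogP _ _ _) | move=> i; apply: H].
rewrite {1}(pihomog_partitionE (leqnn (msize f))); apply: eq_bigr => d _.
by rewrite mul1r.
Qed.

Lemma vanishing_homog d f : f \is d.-homog -> I f <-> forall i, f.@[a i] = 0.
Proof.
move=> hf; rewrite vanishing_idealP; split=> [H i|H e i].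
  by have := H d i; rewrite pihomog_dE.
have [e_d|ne] := eqVneq d e; first by rewrite -e_d pihomog_dE.
by rewrite (pihomog_ne0 ne hf) meval0.
Qed.

Lemma vanishing_hideal : hideal I.
Proof.
split.
- by apply/vanishing_idealP=> d i; rewrite raddf0 meval0.
- move=> f g /vanishing_idealP If /vanishing_idealP Ig.
  by apply/vanishing_idealP=> d i; rewrite raddfD mevalD If Ig addr0.
- move=> p f /vanishing_idealP If; apply/vanishing_idealP=> d i.
  rewrite {1}(pihomog_partitionE (leqnn (msize f))) mulr_sumr pihomog_sum meval_sum.
  rewrite big1 // => e _.
  by rewrite (pihomogM_homog _ _ (pihomogP _ _ _)) mevalM If mulr0.
- move=> d f /vanishing_idealP If; apply/(vanishing_homog (pihomogP _ _ _)).
  exact: If.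
Qed.

Lemma vanishing_proper f : (0 < m)%N -> I f -> f@_0%MM = 0.
Proof.
move=> m0 /vanishing_idealP/(_ 0%N (Ordinal m0)).
have -> : pihomog mdeg 0 f = (f@_0%MM)%:MP.
  apply/mpolyP=> mon; rewrite mcoeff_pihomog mcoeffC mdeg_eq0.
  by case: eqP => [->|_]; rewrite ?mulr1 ?mulr0.
by rewrite mevalC.
Qed.

Context (b : 'I_N -> K).
Local Notation l := (lform b).
Local Notation J := (plus_l I b).
Hypothesis l_ne0 : forall i, l.@[a i] != 0.

Lemma pihomog_lformS d v : pihomog mdeg d.+1 (l * v) = l * pihomog mdeg d v.
Proof. by rewrite pihomog_lform pihomog_hpart -[in RHS](hpart_addS _ _ 1) add0n addn1. Qed.

Lemma vanishing_nzd f : I (l * f) -> I f.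
Proof.
move=> /vanishing_idealP H; apply/vanishing_idealP=> d i.
have := H d.+1 i; rewrite pihomog_lformS mevalM => /eqP.
by rewrite mulf_eq0 (negbTE (l_ne0 i)) => /eqP.
Qed.

(** On a finite set of points, membership in I + (l) only concerns values: those of
    a form of degree [e + 1] have to be l times those of a form of degree [e]. *)
Lemma plus_l_homog e f : f \is e.+1.-homog ->
  J f <-> exists2 g, g \is e.-homog & forall i, f.@[a i] = l.@[a i] * g.@[a i].
Proof.
move=> hf; split=> [[u [v [Iu E]]]|[g hg E]].
  exists (pihomog mdeg e v); first exact: pihomogP.
  move=> i; rewrite -(pihomog_dE hf) E raddfD mevalD /= pihomog_lformS mevalM.
  by move/vanishing_idealP: Iu => ->; rewrite add0r.
exists (f - l * g), g; rewrite subrK; split=> //.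
apply/(@vanishing_homog e.+1); last by move=> i; rewrite mevalB mevalM E subrr.
by rewrite rpredB // -[e.+1]add1n dhomogM // lform_homog.
Qed.

Lemma plus_l_homog0 f : f \is 0.-homog -> J f <-> I f.
Proof.
move=> hf; split=> [[u [v [Iu E]]]|]; last exact: plus_lI.
rewrite -(pihomog_dE hf) E raddfD /= pihomog_lform /hpart /= mulr0 addr0.
exact: (hidH vanishing_hideal).
Qed.

(** The points impose independent conditions on forms of degree [j]. *)
Definition interpolates j : Prop :=
  forall v : 'I_m -> K, exists2 f : R, f \is j.-homog & forall i, f.@[a i] = v i.

Lemma interpolates_up j k : interpolates j -> (j <= k)%N -> interpolates k.
Proof.
move=> Hj /subnK <-; elim: (k - j)%N => [//|d IH] v; rewrite addSn.
have [f hf E] := IH (fun i => v i / l.@[a i]); exists (l * f).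
  by rewrite -[(d + j).+1]add1n dhomogM // lform_homog.
by move=> i; rewrite mevalM E mulrC divfK.
Qed.

Lemma plus_l_above j e f : interpolates j -> (j < e)%N -> f \is e.-homog -> J f.
Proof.
case: e => [//|e] Hj je hf; apply/(plus_l_homog hf).
have [g hg E] := interpolates_up Hj je (fun i => f.@[a i] / l.@[a i]).
by exists g => // i; rewrite E mulrC divfK.
Qed.

Lemma interpolates_down j : (forall f, f \is j.+1.-homog -> J f) ->
  interpolates j.+1 -> interpolates j.
Proof.
move=> HJ Hj v; have [f hf E] := Hj (fun i => l.@[a i] * v i).
have [g hg E'] := (plus_l_homog hf).1 (HJ _ hf); exists g => // i.
by apply: (mulfI (l_ne0 i)); rewrite -E' E.
Qed.

Lemma prod_homog1 k (F : 'I_k -> R) : (forall i, F i \is 1.-homog) ->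
  \prod_i F i \is k.-homog.
Proof.
elim: k F => [|k IH] F hF; first by rewrite big_ord0 dhomog1.
by rewrite big_ord_recl; apply: (dhomogM (hF ord0)); apply: IH.
Qed.

(** For each i, a product over all k of linear forms that vanish at P_k but not at
    P_i; the factor with k = i only keeps the degrees equal. *)
Lemma distinct_interpolates : nonzero_coords a -> distinct_points a -> interpolates m.
Proof.
move=> nz dist.
have sep i k : exists2 f : R, f \is 1.-homog &
    (k = i -> f.@[a i] != 0) /\ (k != i -> f.@[a i] != 0 /\ f.@[a k] = 0).
  have [->|ki] := eqVneq k i.
    have [j aj] := nz i; exists 'X_j; first by rewrite dhomogX /= mdeg1.
    by rewrite mevalXU; split.
  have [j0 akj0] := nz k.
  have [j aj] : exists j, a k j0 * a i j - a k j * a i j0 != 0.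
    apply: NNPP => H; apply: (dist i k); first by rewrite eq_sym.
    exists (a i j0 / a k j0) => j; apply: (mulfI akj0).
    have : a k j0 * a i j - a k j * a i j0 = 0.
      by apply/eqP/negPn/negP => ne; apply: H; exists j.
    by move/subr0_eq => ->; field.
  exists (a k j0 *: 'X_j - a k j *: 'X_j0).
    by rewrite rpredB // rpredZ // dhomogX /= mdeg1.
  have E i' : (a k j0 *: 'X_j - a k j *: 'X_j0 : R).@[a i'] =
      a k j0 * a i' j - a k j * a i' j0 by rewrite mevalB !mevalZ !mevalXU.
  split=> _; rewrite !E //; split=> //.
  by rewrite mulrC subrr.
have [F HF] : exists F : 'I_m * 'I_m -> R, forall p, F p \is 1.-homog /\
    ((p.2 = p.1 -> (F p).@[a p.1] != 0) /\
     (p.2 != p.1 -> (F p).@[a p.1] != 0 /\ (F p).@[a p.2] = 0)).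
  apply: (fin_all_exists (P := fun (p : 'I_m * 'I_m) (f : R) => f \is 1.-homog /\
    ((p.2 = p.1 -> f.@[a p.1] != 0) /\
     (p.2 != p.1 -> f.@[a p.1] != 0 /\ f.@[a p.2] = 0)))) => -[i k] /=.
  by have [f hf Hf] := sep i k; exists f.
pose G i := \prod_k F (i, k).
have Gi i : (G i).@[a i] != 0.
  rewrite /G rmorph_prod; apply/prodf_neq0 => k _.
  have [_ [/= H1 H2]] := HF (i, k).
  by have [/H1|/H2[]] := eqVneq k i.
have Gk i k : k != i -> (G i).@[a k] = 0.
  move=> ki; have [_ [/= _ /(_ ki)[_ F0]]] := HF (i, k).
  by rewrite /G rmorph_prod (bigD1 k) //= F0 mul0r.
move=> v; exists (\sum_i (v i / (G i).@[a i]) *: G i).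
  apply: rpred_sum => i _; apply: rpredZ; apply: prod_homog1 => k.
  by case: (HF (i, k)).
move=> i; rewrite meval_sum (bigD1 i) //= mevalZ divfK // big1 ?addr0 // => k ki.
have ik : i != k by rewrite eq_sym.
by rewrite mevalZ (Gk _ _ ik) mulr0.
Qed.

End Points.

Section Apolarity.
Context {K : fieldType} {N : nat}.
Hypothesis charK0 : [pchar K] =i pred0.
Local Notation R := {mpoly K[N]}.

Lemma natr_neq0 k : (0 < k)%N -> k%:R != 0 :> K.
Proof. by rewrite ((pcharf0P K).1 charK0) lt0n. Qed.

Lemma mderiv_dual_form i (v : 'I_N -> K) : (dual_form v)^`M(i) = (v i)%:MP.
Proof.
rewrite raddf_sum (bigD1 i) //= big1 ?addr0 => [|j ji].
  rewrite linearZ /= mderivX mnm1E eqxx scale1r -{1}[U_(_)%MM]add0m addmK mpolyX0.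
  by rewrite -mul_mpolyC mulr1.
by rewrite linearZ /= mderivX mnm1E (negbTE ji) scale0r scaler0.
Qed.

Lemma mderiv_exp i (p : R) k : (p ^+ k)^`M(i) = k%:R *: (p^`M(i) * p ^+ k.-1).
Proof.
elim: k => [|k IH]; first by rewrite expr0 -mpolyC1 mderivC scale0r.
rewrite exprS mderivM IH /= -scalerAr mulrCA.
case: k {IH} => [|k] /=; first by rewrite expr0 scale0r addr0 scale1r.
by rewrite -exprS -[X in X + _]scale1r -scalerDl nat1r.
Qed.

(** A monomial x^mon of degree k acts on L^r as r(r-1)..(r-k+1) times its value at
    the point dual to L, times L^(r-k). *)
Lemma mderivm_dual_form_exp (v : 'I_N -> K) r mon :
  (dual_form v ^+ r)^`M[mon] =
  ((r ^_ (mdeg mon))%:R * ('X_[mon] : R).@[v]) *: dual_form v ^+ (r - mdeg mon).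
Proof.
have [d] := ubnP (mdeg mon); elim: d => // d IH in mon *; rewrite ltnS => le.
have [/eqP|] := posnP (mdeg mon).
  rewrite mdeg_eq0 => /eqP ->.
  by rewrite mderivm0m mdeg0 ffactn0 mpolyX0 meval1 mulr1 scale1r subn0.
rewrite lt0n mdeg_eq0 => m0.
have [i mi] : exists i, mon i != 0%N.
  apply: NNPP => H; case/eqP: m0; apply/mnmP=> i; rewrite mnm0E.
  by apply/eqP/negPn/negP=> ne; apply: H; exists i.
have em : (mon = mon - U_(i) + U_(i))%MM by rewrite submK // lep1mP.
move: em le; set mon' := (mon - U_(i))%MM => ->.
rewrite mdegD mdeg1 addn1 => le.
rewrite mderivmDm IH // mderivmU1m linearZ /= mderiv_exp mderiv_dual_form.
rewrite mul_mpolyC !scalerA ffactnSr natrM mpolyXD mevalM mevalXU -subnS.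
by congr (_ *: _); ring.
Qed.

Context {m : nat} (a : 'I_m -> 'I_N -> K) (r : nat).
Implicit Types c : 'I_m -> K.
Local Notation L i := (dual_form (a i)).

Lemma pihomog_diff_act c (f : R) k : (k <= r)%N ->
  pihomog mdeg (r - k) (diff_act f (\sum_i c i *: L i ^+ r)) =
  \sum_i ((r ^_ k)%:R * c i * (pihomog mdeg k f).@[a i]) *: L i ^+ (r - k).
Proof.
move=> kr; rewrite /diff_act pihomog_sum.
transitivity (\sum_(mon <- msupp f) \sum_i
   (if mdeg mon == k then (f@_mon * c i * (r ^_ k)%:R * ('X_[mon] : R).@[a i]) *:
      L i ^+ (r - k) else 0)).
  apply: eq_bigr => mon _; rewrite linear_sum scaler_sumr pihomog_sum; apply: eq_bigr => i _ /=.
  rewrite mderivmZ mderivm_dual_form_exp !scalerA pihomogZ.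
  have hL : L i ^+ (r - mdeg mon) \is (r - mdeg mon).-homog.
    exact: dual_form_pow_homog.
  case: eqP => [<-|/eqP ne].
    by rewrite (pihomog_dE hL) !mulrA.
  have [lt|le] := ltnP r (mdeg mon).
    by rewrite ffact_small // mul0r mulr0 scale0r.
  rewrite (pihomog_ne0 _ hL) ?scaler0 //.
  by apply: contraNneq ne => e; apply/eqP; lia.
rewrite exchange_big; apply: eq_bigr => i _ /=.
rewrite -big_mkcond -scaler_suml; congr (_ *: _).
rewrite /pihomog meval_sum mulr_sumr; apply: eq_bigr => mon _ /=.
by rewrite mevalZ; ring.
Qed.

Lemma pihomog_diff_act_high c (f : R) d : (r < d)%N ->
  pihomog mdeg d (diff_act f (\sum_i c i *: L i ^+ r)) = 0.
Proof.
move=> rd; rewrite /diff_act pihomog_sum big1 // => mon _.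
rewrite linear_sum scaler_sumr pihomog_sum big1 // => i _ /=.
rewrite mderivmZ mderivm_dual_form_exp !scalerA pihomogZ.
rewrite (pihomog_ne0 _ (dual_form_pow_homog (a i) (r - mdeg mon))) ?scaler0 //.
by apply/eqP => e; move: rd; rewrite -e ltnNge leq_subr.
Qed.

Lemma mpoly_pihomog0 (G : R) : (forall d, pihomog mdeg d G = 0) -> G = 0.
Proof.
move=> H; rewrite (pihomog_partitionE (leqnn (msize G))) big1 // => d _; exact: H.
Qed.

End Apolarity.

Section ApolarityPairing.
Context {K : fieldType} {N : nat}.
Hypothesis charK0 : [pchar K] =i pred0.
Local Notation R := {mpoly K[N]}.
Context {m : nat} (a : 'I_m -> 'I_N -> K).
Implicit Types c : 'I_m -> K.
Local Notation L i := (dual_form (a i)).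

(** Apolarity: a form f of degree j sends L_i^j to j! f(P_i), and in characteristic
    zero the action of monomials of degree j detects every coefficient. *)
Lemma sum_pow_eq0 c j : \sum_i c i *: L i ^+ j = 0 <->
  forall f : R, f \is j.-homog -> \sum_i c i * f.@[a i] = 0.
Proof.
split=> [E f hf|H].
  have := pihomog_diff_act a c f (leqnn j); rewrite E.
  rewrite /diff_act big1 => [|mon _]; last by rewrite raddf0 scaler0.
  rewrite raddf0 subnn pihomog_dE // => /esym.
  under eq_bigr => i _ do rewrite expr0 -mulrA -scalerA.
  rewrite -scaler_sumr -scaler_suml => /eqP; rewrite scaler_eq0 scaler_eq0.
  rewrite (negbTE (natr_neq0 charK0 _)) ?ffactnn ?fact_gt0 //=.
  by rewrite oner_eq0 orbF => /eqP.
set G := \sum_i _; have hG : G \is j.-homog.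
  by apply: rpred_sum => i _; apply: rpredZ; apply: dual_form_pow_homog.
apply/mpolyP=> mon; rewrite mcoeff0.
have [dm|ne] := eqVneq (mdeg mon) j; last exact: (dhomog_nemf_coeff hG).
have := mcoeff_mderivm mon G 0%MM; rewrite addm0.
have -> : G^`M[mon] = 0.
  rewrite /G raddf_sum /=.
  under eq_bigr => i _ do
    rewrite linearZ /= mderivm_dual_form_exp dm subnn expr0 scalerA mulrCA -scalerA.
  rewrite -scaler_sumr; under eq_bigr => i _ do rewrite -mul_mpolyC mulr1.
  rewrite -rmorph_sum /= H ?rmorph0 ?scaler0 //.
  by rewrite dhomogX; apply/eqP.
rewrite mcoeff0 -mulr_natr => /esym/eqP; rewrite mulf_eq0 => /orP[/eqP //|].
rewrite (negbTE (natr_neq0 charK0 _)) //.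
by apply: prodn_gt0 => i; rewrite ffactnn fact_gt0.
Qed.

(** The part of f of degree k contributes to the part of degree r - k of the
    result, so the parts of f can be tested separately by [sum_pow_eq0]. *)
Lemma Ann_sum_pow c r (f : R) : Ann (\sum_i c i *: L i ^+ r) f <->
  forall k g, (k <= r)%N -> g \is (r - k).-homog ->
    \sum_i c i * ((pihomog mdeg k f).@[a i] * g.@[a i]) = 0.
Proof.
have key k : (k <= r)%N ->
    pihomog mdeg (r - k) (diff_act f (\sum_i c i *: L i ^+ r)) = 0 <->
    forall g, g \is (r - k).-homog ->
      \sum_i c i * ((pihomog mdeg k f).@[a i] * g.@[a i]) = 0.
  move=> kr; rewrite pihomog_diff_act // sum_pow_eq0.
  have nz : (r ^_ k)%:R != 0 :> K by apply: natr_neq0 => //; rewrite ffact_gt0.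
  have E g : \sum_i (r ^_ k)%:R * c i * (pihomog mdeg k f).@[a i] * g.@[a i] =
      (r ^_ k)%:R * \sum_i c i * ((pihomog mdeg k f).@[a i] * g.@[a i]).
    by rewrite mulr_sumr; apply: eq_bigr => i _; rewrite !mulrA.
  split=> H g hg; have := H g hg; rewrite E; last by move=> ->; rewrite mulr0.
  by move/eqP; rewrite mulf_eq0 (negbTE nz) => /eqP.
split=> [A k g kr|H].
  by move: g; apply/(key _ kr); rewrite A raddf0.
apply: mpoly_pihomog0 => d; have [rd|dr] := ltnP r d.
  exact: pihomog_diff_act_high.
rewrite -(subKn dr); apply/key; first exact: leq_subr.
by move=> g; apply: H; rewrite leq_subr.
Qed.

End ApolarityPairing.

(** * Orthogonality in coordinate space and generic choices *)

Section RowSpaces.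
Context {K : fieldType} {m : nat}.
Local Notation V := 'rV[K]_m.

Lemma vspace_row_free (U : {vspace V}) :
  exists B : 'M[K]_(\dim U, m), row_free B /\ forall u, u \in U <-> (u <= B)%MS.
Proof.
pose B : 'M[K]_(\dim U, m) := \matrix_t (vbasis U)`_t.
have mulB (w : 'rV_(\dim U)) : w *m B = \sum_t w 0 t *: (vbasis U)`_t.
  by rewrite mulmx_sum_row; apply: eq_bigr => t _; rewrite rowK.
exists B; split.
  apply: inj_row_free => w; rewrite mulB => w0.
  have /freeP/(_ (fun t => w 0 t) w0) H := basis_free (vbasisP U).
  by apply/rowP=> t; rewrite H mxE.
move=> u; split=> [uU|/submxP[w ->]].
  apply/submxP; exists (\row_t coord (vbasis U) t u); rewrite mulB [LHS](coord_vbasis uU).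
  by apply: eq_bigr => t _; rewrite mxE.
rewrite mulB; apply: memv_suml => t _; apply: memvZ; apply: vbasis_mem.
by apply: mem_nth; rewrite size_tuple.
Qed.

Lemma row_space_vspace p (A : 'M[K]_(p, m)) :
  exists W : {vspace V}, (forall u, u \in W <-> (u <= A)%MS) /\ \dim W = \rank A.
Proof.
pose C := row_base A; pose X := [tuple row t C | t < \rank A].
have XE (t : 'I_(\rank A)) : X`_t = row t C by rewrite -tnth_nth tnth_mktuple.
have mulC (w : 'rV_(\rank A)) : w *m C = \sum_t w 0 t *: X`_t.
  by rewrite mulmx_sum_row; apply: eq_bigr => t _; rewrite XE.
exists <<X>>%VS; split.
  move=> u; have -> : (u <= A)%MS = (u <= C)%MS by rewrite /C eq_row_base.
  split=> [/coord_span E|/submxP[w ->]].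
    apply/submxP; exists (\row_t coord X t u); rewrite mulC [LHS]E.
    by apply: eq_bigr => t _; rewrite mxE.
  rewrite mulC; apply: memv_suml => t _; apply: memvZ; apply: memv_span.
  by apply: mem_nth; rewrite size_tuple.
suff /eqP : free X by rewrite size_tuple.
apply/freeP => k k0 t.
have : (\row_t k t) *m C = 0.
  by rewrite mulC -[RHS]k0; apply: eq_bigr => t' _; rewrite mxE.
move/eqP; rewrite mulmx_free_eq0 ?row_base_free // => /eqP/rowP/(_ t).
by rewrite !mxE.
Qed.

(** The form \sum e_i u_i v_i is non-degenerate. *)
Lemma perp_dim (e : 'I_m -> K) (U : {vspace V}) : (forall i, e i != 0) ->
  exists W : {vspace V},
    (forall u, u \in W <-> forall v, v \in U -> \sum_i e i * (u 0 i * v 0 i) = 0) /\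
    (\dim W + \dim U)%N = m.
Proof.
move=> e0; have [B [Bfree UB]] := vspace_row_free U.
pose E := diag_mx (\row_i e i); pose M := E *m B^T.
have [W [WM dW]] := row_space_vspace (kermx M).
have rM : \rank M = \dim U.
  rewrite -mxrank_tr trmx_mul trmxK tr_diag_mx mxrankMfree; first exact/eqP.
  rewrite row_free_unit unitmxE det_diag unitfE; apply/prodf_neq0 => i _.
  by rewrite mxE.
exists W; split; last by rewrite dW mxrank_ker rM subnK // -rM rank_leq_row.
have dot u v : (u *m E *m v^T) 0 0 = \sum_i e i * (u 0 i * v 0 i).
  rewrite mxE; apply: eq_bigr => i _; rewrite mul_mx_diag !mxE.
  by rewrite mulrAC mulrC mulrA.
move=> u; rewrite WM; split=> [/sub_kermxP uM v /UB/submxP[w ->]|H].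
  by rewrite -dot trmx_mul mulmxA -(mulmxA u) uM mul0mx mxE.
apply/sub_kermxP/rowP=> t; rewrite mulmxA [RHS]mxE.
transitivity ((u *m E *m (row t B)^T) 0 0).
  by rewrite mxE [RHS]mxE; apply: eq_bigr => i _; congr (_ * _); rewrite !mxE.
by rewrite dot; apply: H; apply/UB; apply: row_sub.
Qed.

End RowSpaces.

Section Infinite.
Context {K : fieldType}.
Hypothesis charK0 : [pchar K] =i pred0.

Lemma poly_nonroot (p : {poly K}) : p != 0 -> exists x, p.[x] != 0.
Proof.
move=> p0; apply: NNPP => H.
pose s := [seq i%:R : K | i <- iota 0 (size p)].
have us : uniq s.
  rewrite map_inj_in_uniq ?iota_uniq // => i j _ _ /eqP.
  wlog lt : i j / (i <= j)%N.
    by move=> W; have [/W//|/ltnW/W W'] := leqP i j; rewrite eq_sym => /W' ->.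
  rewrite eq_sym -subr_eq0 -natrB // ((pcharf0P K).1 charK0) subn_eq0 => le.
  by apply/eqP; rewrite eqn_leq lt.
have rs : all (root p) s.
  by apply/allP=> x _; apply/negPn/negP => nr; apply: H; exists x.
by have := max_poly_roots p0 rs us; rewrite size_map size_iota ltnn.
Qed.

(** Coefficient vectors (1, x, x^2, ..) on the moment curve: every point excludes
    only the roots of one non-zero polynomial. *)
Lemma generic_linear_form n m (a : 'I_m -> 'I_n.+1 -> K) : nonzero_coords a ->
  exists b : 'I_n.+1 -> K, forall i, (lform b).@[a i] != 0.
Proof.
move=> nz; pose p i : {poly K} := \poly_(j < n.+1) a i (inord j).
have p0 i : p i != 0.
  have [j aij] := nz i; apply: contraNneq aij => /(congr1 (fun q : {poly K} => q`_j)).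
  by rewrite coef_poly ltn_ord inord_val coef0 => ->.
have [x] := @poly_nonroot (\prod_i p i) (introT (prodf_neq0 _ _) (fun i _ => p0 i)).
rewrite horner_prod => /prodf_neq0 px; exists (fun j => x ^+ j) => i.
rewrite /lform meval_sum; have := px i isT; rewrite horner_poly.
congr (_ != 0); apply: eq_bigr => j _.
by rewrite mevalM mevalC mevalXU inord_val mulrC.
Qed.

(** Uniqueness among tuples without zero entries forces the whole solution space to
    be a line: for generic x the solution d + x d' has no zero entry either. *)
Lemma proportional_of_unique m (P : ('I_m -> K) -> Prop) (d d' : 'I_m -> K) :
  (forall (s : K) u v, P u -> P v -> P (fun i => u i + s * v i)) ->
  unique_nonzero_upto_scalar P d -> P d' -> exists t, forall i, d' i = t * d i.
Proof.
move=> lin [d0 Pd uniq] Pd'.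
(* the factor X keeps the scalar non-zero *)
pose p : {poly K} := 'X * \prod_i ((d i)%:P + d' i *: 'X).
have p0 : p != 0.
  rewrite mulf_neq0 ?polyX_eq0 //; apply/prodf_neq0 => i _.
  apply: contraNneq (d0 i) => /(congr1 (fun q : {poly K} => q`_0)).
  by rewrite coefD coefC coefZ coefX mulr0 addr0 coef0 => ->.
have [x] := poly_nonroot p0; rewrite hornerM hornerX horner_prod mulf_eq0 negb_or.
case/andP=> x0 /prodf_neq0 px.
have [i|t _ E] := uniq (fun i => d i + x * d' i) _ (lin x _ _ Pd Pd').
  by have := px i isT; rewrite hornerD hornerC hornerZ hornerX mulrC.
exists ((t - 1) / x) => i; apply: (mulfI x0).
have -> : x * d' i = t * d i - d i by rewrite -(E i) addrAC subrr add0r.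
by field.
Qed.

End Infinite.

(** * Gorenstein Artinian reductions *)

Section GorensteinSection.
Context {K : fieldType} {n m : nat}.
Hypothesis charK0 : [pchar K] =i pred0.
Context (a : 'I_m -> 'I_n.+1 -> K) (b : 'I_n.+1 -> K).
Local Notation N := n.+1.
Local Notation R := {mpoly K[N]}.
Local Notation I := (vanishing_ideal a).
Local Notation l := (lform b).
Local Notation J := (plus_l I b).
Hypothesis l_ne0 : forall i, l.@[a i] != 0.
Let HI := vanishing_hideal a.
Let HJ := plus_l_hideal HI b.

(** R/(I + (l)) is an Artinian Gorenstein algebra of socle degree [r]. *)
Record gorenstein_section (r : nat) : Prop := GorensteinSection {
  gs_above : forall e f, (r < e)%N -> f \is e.-homog -> J f;
  gs_nonzero : exists2 g : R, g \is r.-homog & ~ J g;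
  gs_socle : forall e g, socle I b e g -> ~ J g -> e = r;
  gs_dim1 : forall g1 g2 : R, g1 \is r.-homog -> g2 \is r.-homog -> ~ J g2 ->
    exists c : K, J (g1 - c%:MP * g2) }.

Lemma J_homog_parts f : J f <-> forall d, J (pihomog mdeg d f).
Proof.
split=> [Jf d|H]; first exact: (hidH HJ).
rewrite (pihomog_partitionE (leqnn (msize f))).
by elim/big_ind: _ => // [|u v]; [exact: (hid0 HJ) | exact: (hidD HJ)].
Qed.

Lemma mulX_homog d i (g : R) : g \is d.-homog -> 'X_i * g \is d.+1.-homog.
Proof.
have hX : ('X_i : R) \is 1.-homog by rewrite dhomogX /= mdeg1.
exact: dhomogM hX.
Qed.

Lemma mull_homog d (g : R) : g \is d.-homog -> l * g \is d.+1.-homog.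
Proof. exact: (dhomogM (lform_homog b)). Qed.

Lemma socle_top r g : (forall e f, (r < e)%N -> f \is e.-homog -> J f) ->
  g \is r.-homog -> socle I b r g.
Proof.
by move=> above hg; split=> // i; apply: (above r.+1) => //; apply: mulX_homog.
Qed.

Definition evalform (c : 'I_m -> K) (f : R) : K := \sum_i c i * f.@[a i].

Lemma evalformD c f g : evalform c (f + g) = evalform c f + evalform c g.
Proof. by rewrite -big_split; apply: eq_bigr => i _; rewrite mevalD mulrDr. Qed.

Lemma evalformZ c (x : K) f : evalform c (x%:MP * f) = x * evalform c f.
Proof.
by rewrite mulr_sumr; apply: eq_bigr => i _; rewrite mevalM mevalC mulrCA.
Qed.

Lemma evalform_scale c x f : evalform (fun i => x * c i) f = x * evalform c f.
Proof. by rewrite mulr_sumr; apply: eq_bigr => i _; rewrite mulrA. Qed.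

(** In degree [r] the values of I + (l) on the points are l times the values of
    forms of degree [r - 1]; so the relations among the powers L_i^(r-1) are
    exactly the functionals that vanish on it. *)
Lemma evalform_J c r : \sum_(i < m) (c i * l.@[a i]) *: pow_pred (dual_form (a i)) r = 0 <->
  forall f, f \is r.-homog -> J f -> evalform c f = 0.
Proof.
case: r => [|r] /=.
  split=> _; last by rewrite big1 // => i _; rewrite scaler0.
  move=> f hf /(plus_l_homog0 a b hf)/(vanishing_homog a hf) f0.
  by rewrite /evalform big1 // => i _; rewrite f0 mulr0.
rewrite (sum_pow_eq0 charK0); split=> H.
  move=> f hf /(plus_l_homog a b hf)[g hg E]; rewrite -[RHS](H g hg).
  by apply: eq_bigr => i _; rewrite E mulrA.
move=> g hg; rewrite -[RHS](H (l * g)).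
- by apply: eq_bigr => i _; rewrite mevalM mulrA.
- exact: mull_homog.
- exact: (plus_l_mul HI).
Qed.

(** A non-zero element of a graded Gorenstein algebra has a non-zero multiple in
    the socle degree: if all products with variables vanish it is in the socle
    itself. *)
Lemma J_of_products r k f : gorenstein_section r -> f \is k.-homog -> (k <= r)%N ->
  (forall g : R, g \is (r - k).-homog -> J (f * g)) -> J f.
Proof.
move=> G; move dE: (r - k)%N => d; elim: d k f dE => [|d IH] k f dE hf kr H.
  by rewrite -[f]mulr1; apply: H; rewrite dhomog1.
apply: NNPP => nJ; have sf : socle I b k f.
  split=> // i; apply: (IH k.+1); [lia | exact: mulX_homog | lia |].
  by move=> g hg; have := H _ (mulX_homog i hg); rewrite mulrA [f * _]mulrC.
by have := gs_socle G sf nJ; lia.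
Qed.

(** Both ideals are read off from the same functional in degree [r]: on the left
    by apolarity, on the right by [J_of_products]. *)
Lemma Ann_of_evalform r c f : gorenstein_section r ->
  (forall g, g \is r.-homog -> evalform c g = 0 <-> J g) ->
  Ann (\sum_i c i *: dual_form (a i) ^+ r) f <-> J f.
Proof.
move=> G H; rewrite (Ann_sum_pow charK0) J_homog_parts.
have E k g : (k <= r)%N -> g \is (r - k).-homog ->
    \sum_i c i * ((pihomog mdeg k f).@[a i] * g.@[a i]) = 0 <->
    J (pihomog mdeg k f * g).
  move=> kr hg; rewrite -H.
    rewrite /evalform (eq_bigr (fun i => c i * (pihomog mdeg k f * g).@[a i])) //.
    by move=> i _; rewrite mevalM.
  by rewrite -{1}(subnKC kr); apply: dhomogM; first exact: pihomogP.
split=> [A k|Jf k g kr hg]; last first.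
  by apply/(E _ _ kr hg); rewrite mulrC; apply: (hidM HJ).
have [rk|kr] := ltnP r k; first exact: (gs_above G rk (pihomogP _ _ _)).
apply: (J_of_products G (pihomogP _ _ _) kr) => g hg.
by apply/(E _ _ kr hg); apply: A.
Qed.

Lemma gorenstein_interpolates r : gorenstein_section r ->
  (exists j, interpolates a j) -> interpolates a r.
Proof.
move=> G [j Hj]; have {Hj} := interpolates_up l_ne0 Hj (leq_maxl j r).
have: (r <= maxn j r)%N by exact: leq_maxr.
move: (maxn j r) => k /subnK <-; elim: (k - r)%N => [//|d IH]; rewrite addSn => H.
apply/IH/(interpolates_down l_ne0 _ H) => f hf.
by apply: (gs_above G _ hf); rewrite ltnS leq_addl.
Qed.

Lemma J_scale (x : K) g : J (x%:MP * g) -> ~ J g -> x = 0.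
Proof.
move=> Jx nJ; apply/eqP/negPn/negP => x0; apply: nJ.
rewrite -[g]mul1r -mpolyC1 -(mulVf x0) mpolyCM -mulrA; exact: (hidM HJ).
Qed.

(** The degree r part of R/(I + (l)) is a line, and a form is determined modulo I
    by its values on the points; c_i is the coordinate of the form of degree r
    that is 1 at P_i and 0 at the other points. *)
Lemma gorenstein_functional r : gorenstein_section r -> interpolates a r ->
  exists c, (forall g, g \is r.-homog -> evalform c g = 0 <-> J g).
Proof.
move=> G Hr; have [g0 hg0 nJ0] := gs_nonzero G.
have [c Hc] : exists c : 'I_m -> K, forall i, exists2 e : R, e \is r.-homog &
    (forall k, e.@[a k] = (k == i)%:R) /\ J (e - (c i)%:MP * g0).
  apply: (fin_all_exists (P := fun i x => exists2 e : R, e \is r.-homog &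
    (forall k, e.@[a k] = (k == i)%:R) /\ J (e - x%:MP * g0))) => i.
  have [e he E] := Hr (fun k => (k == i)%:R).
  by have [x Jx] := gs_dim1 G he hg0 nJ0; exists x, e.
exists c => f hf.
have Jf : J (f - (evalform c f)%:MP * g0).
  have [E HE] : exists E : 'I_m -> R, forall i, E i \is r.-homog /\
      ((forall k, (E i).@[a k] = (k == i)%:R) /\ J (E i - (c i)%:MP * g0)).
    apply: (fin_all_exists (P := fun i (e : R) => e \is r.-homog /\
      ((forall k, e.@[a k] = (k == i)%:R) /\ J (e - (c i)%:MP * g0)))) => i.
    by have [e he H] := Hc i; exists e.
  have -> : f - (evalform c f)%:MP * g0 = (f - \sum_i (f.@[a i])%:MP * E i) +
      \sum_i (f.@[a i])%:MP * (E i - (c i)%:MP * g0).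
    rewrite /evalform rmorph_sum mulr_suml /= -addrA; congr (_ + _).
    rewrite -!sumrN -big_split; apply: eq_bigr => i _ /=.
    by rewrite rmorphM /=; ring.
  apply: (hidD HJ).
    apply: plus_lI; apply/(vanishing_homog a (d := r)).
      apply: rpredB => //; apply: rpred_sum => i _; rewrite mul_mpolyC rpredZ //.
      by case: (HE i).
    move=> k; rewrite mevalB meval_sum (bigD1 k) //= big1 => [|i ik].
      by rewrite mevalM mevalC; case: (HE k) => _ [-> _]; rewrite eqxx mulr1 addr0 subrr.
    rewrite mevalM mevalC; case: (HE i) => _ [-> _].
    by rewrite eq_sym (negbTE ik) mulr0.
  elim/big_ind: _ => [||i _]; [exact: (hid0 HJ) | exact: (hidD HJ) |].
  by apply: (hidM HJ); case: (HE i) => _ [].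
split=> [e0|JJ]; first by move: Jf; rewrite e0 mpolyC0 mul0r subr0.
apply: (J_scale _ nJ0).
have := hidD HJ JJ (hidM HJ (-1) Jf).
by rewrite mulN1r subKr.
Qed.

(** If c_i = 0, a form that vanishes at all points but P_i annihilates
    \sum c_k L_k^r, hence lies in I + (l). Division by l on the points then gives
    such a form of smaller degree, without end. *)
Lemma functional_nonzero r c i : gorenstein_section r -> interpolates a r ->
  (forall g, g \is r.-homog -> evalform c g = 0 <-> J g) -> c i != 0.
Proof.
move=> G Hr H; apply/eqP => ci0.
(* forms of degree d that separate P_i from the other points *)
pose P d := exists2 f : R, f \is d.-homog &
  f.@[a i] != 0 /\ forall k, k != i -> f.@[a k] = 0.
have [d [[f hf [fi fk]] least]] : exists d, P d /\ forall d', (d' < d)%N -> ~ P d'.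
  apply: ex_least; exists r; have [f hf E] := Hr (fun k => (k == i)%:R); exists f => //.
  by split=> [|k ki]; rewrite E ?eqxx ?oner_eq0 // (negbTE ki).
have Jf : J f.
  apply/(Ann_of_evalform f G H)/(Ann_sum_pow charK0) => k g kr hg.
  rewrite big1 // => i' _; have [->|ne] := eqVneq i' i; first by rewrite ci0 mul0r.
  have [<-|kd] := eqVneq d k; first by rewrite pihomog_dE // fk // mul0r mulr0.
  by rewrite (pihomog_ne0 kd hf) meval0 mul0r mulr0.
case: d => [|d] in hf least.
  move/(plus_l_homog0 a b hf)/(vanishing_homog a hf)/(_ i): Jf => f0.
  by rewrite f0 eqxx in fi.
have [g hg E] := (plus_l_homog a b hf).1 Jf.
apply: (least d) => //; exists g => //; split=> [|k ki].
  by apply: contraNneq fi => g0; rewrite E g0 mulr0.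
by have /eqP := E k; rewrite fk // eq_sym mulf_eq0 (negbTE (l_ne0 k)) => /eqP.
Qed.

(** Both functionals factor through the line R_r modulo I + (l). *)
Lemma functional_unique r c c' : gorenstein_section r -> interpolates a r ->
  (forall g, g \is r.-homog -> evalform c g = 0 <-> J g) ->
  (forall g, g \is r.-homog -> J g -> evalform c' g = 0) ->
  exists t, forall i, c' i = t * c i.
Proof.
move=> G Hr H H'; have [g0 hg0 nJ0] := gs_nonzero G.
have c0 : evalform c g0 != 0 by apply/eqP => e0; apply/nJ0/(H _ hg0).
have E f : f \is r.-homog ->
    evalform c' f = evalform c' g0 / evalform c g0 * evalform c f.
  move=> hf; pose x := evalform c f / evalform c g0.
  have hx : f + (- x)%:MP * g0 \is r.-homog.
    by rewrite mul_mpolyC rpredD // rpredZ.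
  have : evalform c' (f + (- x)%:MP * g0) = 0.
    by apply: (H' _ hx); apply/(H _ hx); rewrite evalformD evalformZ /x; field.
  rewrite evalformD evalformZ mulNr => /subr0_eq ->; rewrite /x.
  by field.
exists (evalform c' g0 / evalform c g0) => i.
have [f hf Ef] := Hr (fun k => (k == i)%:R).
have ev (u : 'I_m -> K) : evalform u f = u i.
  rewrite /evalform (bigD1 i) //= Ef eqxx mulr1 big1 ?addr0 // => k ki.
  by rewrite Ef (negbTE ki) mulr0.
by rewrite -[LHS]ev (E _ hf) ev.
Qed.

Lemma gorenstein_unique_relation r : gorenstein_section r -> (0 < m)%N ->
  (exists j, interpolates a j) ->
  exists c : 'I_m -> K,
    unique_nonzero_upto_scalar (fun c' => \sum_(i < m)
       (c' i * l.@[a i]) *: pow_pred (dual_form (a i)) r = 0) c /\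
    forall f, J f <-> Ann (\sum_(i < m) c i *: dual_form (a i) ^+ r) f.
Proof.
move=> G m0 /(gorenstein_interpolates G) Hr.
have [c H] := gorenstein_functional G Hr; exists c; split; last first.
  by move=> f; apply: iff_sym; apply: Ann_of_evalform.
split; first by move=> i; apply: functional_nonzero H.
  by apply/evalform_J => f hf; apply: (H f hf).2.
move=> c' c'0 /evalform_J H'.
have [t E] := functional_unique G Hr H H'; exists t => //.
by apply: contraNneq (c'0 (Ordinal m0)) => t0; rewrite E t0 mul0r.
Qed.

End GorensteinSection.

(** * From resolutions and from symmetric h-vectors to Gorenstein reductions *)

Section FromResolution.
Context {K : fieldType} {n m : nat}.
Hypothesis charK0 : [pchar K] =i pred0.
Context (a : 'I_m -> 'I_n.+1 -> K) (b : 'I_n.+1 -> K).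
Local Notation N := n.+1.
Local Notation R := {mpoly K[N]}.
Local Notation I := (vanishing_ideal a).
Local Notation l := (lform b).
Local Notation J := (plus_l I b).
Hypothesis l_ne0 : forall i, l.@[a i] != 0.
Let HI := vanishing_hideal a.
Let nzd := vanishing_nzd l_ne0.

(** I + (l) contains all forms of large degree, but not 1. *)
Lemma top_socle_degree : (0 < m)%N -> (exists j, interpolates a j) ->
  exists s, (forall e f, (s < e)%N -> f \is e.-homog -> J f) /\
            exists2 g : R, g \is s.-homog & ~ J g.
Proof.
move=> m0 [j Hj].
have [|s [above least]] := @ex_least (fun s => forall e f, (s < e)%N ->
    f \is e.-homog -> J f).
  by exists j => e f; apply: (plus_l_above l_ne0 Hj).
exists s; split=> //; case: s above least => [|s] above least.
  have h1 : (1 : R) \is 0.-homog by exact: dhomog1.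
  exists 1 => // /(plus_l_homog0 a b h1)/(vanishing_homog a h1)/(_ (Ordinal m0))/eqP.
  by rewrite meval1 oner_eq0.
apply: NNPP => H; apply: (least s) => // e f se hf.
have [es|ne] := eqVneq e s.+1; last by apply: (above e) => //; lia.
by apply: NNPP => nJ; apply: H; exists f; rewrite -?es.
Qed.

(** The single generator of F_n makes the socle of R/(I + (l)) a line. Its degree
    is the regularity: socle elements give twists of F_n, and conversely no twist
    exceeds the last degree of R/(I + (l)). *)
Lemma gorenstein_of_resolutions r sh df sh' df' : (0 < m)%N ->
  (exists j, interpolates a j) ->
  @min_graded_complex K n I sh df -> size (sh n) = 1%N ->
  @min_graded_complex K n I sh' df' ->
  (forall i t, t \in sh' i -> (t <= r + i)%N) -> (exists i, (r + i)%N \in sh' i) ->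
  gorenstein_section a b r.
Proof.
move=> m0 Hj HF sz HF' reg [i0 reg0].
have [s [above [g0 hg0 nJ0]]] := top_socle_degree m0 Hj.
have sg0 := socle_top above hg0.
have sr : s = r.
  apply/eqP; rewrite eqn_leq; apply/andP; split.
    have := reg _ _ (socle_shift charK0 HI HF' nzd sg0 nJ0).
    by rewrite leq_add2r.
  have /(nthP 0%N)[t lt E] := reg0.
  have := shift_le charK0 HI HF' nzd (Ordinal lt) above.
  by rewrite /shf /= E leq_add2r.
rewrite sr in above sg0 hg0.
have one_shift e g : socle I b e g -> ~ J g -> (e + n)%N = nth 0%N (sh n) 0.
  move=> sg nJ; have /(nthP 0%N)[t] := socle_shift charK0 HI HF nzd sg nJ.
  by rewrite sz ltnS leqn0 => /eqP -> ->.
split=> //; first by exists g0.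
  move=> e g sg nJ; apply/eqP; rewrite -(eqn_add2r n) (one_shift _ _ sg nJ).
  by rewrite (one_shift _ _ sg0 nJ0).
move=> g1 g2 h1 h2 nJ2.
exact: (socle_dim1 charK0 HI HF nzd sz (socle_top above h1) (socle_top above h2) nJ2).
Qed.

End FromResolution.

Section FromSymmetry.
Context {K : fieldType} {n m : nat}.
Hypothesis charK0 : [pchar K] =i pred0.
Context (a : 'I_m -> 'I_n.+1 -> K).
Local Notation N := n.+1.
Local Notation R := {mpoly K[N]}.
Local Notation I := (vanishing_ideal a).

(** Values of a form on the points, scaled by the weights [w]. With all weights 1
    the image in degree [j] has the value of the Hilbert function as dimension. *)
Definition wrow (w : 'I_m -> K) j (f : dhomog N K j) : 'rV[K]_m :=
  \row_i (w i * (val f).@[a i]).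

Lemma wrow_is_linear w j : linear (@wrow w j).
Proof.
by move=> c f g; apply/rowP=> i; rewrite !mxE /= mevalD mevalZ; ring.
Qed.
HB.instance Definition _ w j :=
  GRing.isLinear.Build K (dhomog N K j) 'rV[K]_m _ (@wrow w j) (@wrow_is_linear w j).

Definition wval w j : {vspace 'rV[K]_m} := limg (linfun (@wrow w j)).

Lemma wvalP w j v : v \in wval w j <->
  exists2 f : R, f \is j.-homog & forall i, v 0 i = w i * f.@[a i].
Proof.
split=> [/memv_imgP[f _ ->]|[f hf E]].
  exists (val f); first exact: dhomog_is_dhomog.
  by move=> i; rewrite lfunE mxE.
apply/memv_imgP; exists (DHomog hf); first exact: memvf.
by apply/rowP=> i; rewrite lfunE mxE E.
Qed.

Lemma wrow_ker w j f : (forall i, w i != 0) ->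
  f \in lker (linfun (@wrow w j)) <-> I (val f).
Proof.
move=> w0; rewrite (vanishing_homog a (dhomog_is_dhomog f)) memv_ker lfunE.
split=> [/eqP/rowP H i|H].
  by have /eqP := H i; rewrite !mxE mulf_eq0 (negbTE (w0 i)) => /eqP.
by apply/eqP/rowP=> i; rewrite !mxE H mulr0.
Qed.

Lemma hilbert_wval w j (U : {vspace dhomog N K j}) h : (forall i, w i != 0) ->
  (forall f, f \in U <-> I (val f)) -> (\dim U + h = \dim {: dhomog N K j})%N ->
  h = \dim (wval w j).
Proof.
move=> w0 HU; have -> : U = lker (linfun (@wrow w j)).
  apply/vspaceP=> f; apply/idP/idP => [/HU|]; first by move/(wrow_ker f w0).
  by move/(wrow_ker f w0)/HU.
by rewrite -(limg_ker_dim (linfun (@wrow w j)) fullv) capfv => /addnI.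
Qed.

Lemma wval_dim w w' j : (forall i, w i != 0) -> (forall i, w' i != 0) ->
  \dim (wval w j) = \dim (wval w' j).
Proof.
move=> w0 w'0; apply: (@hilbert_wval _ _ (lker (linfun (@wrow w j)))) => //.
  by move=> f; apply: wrow_ker.
by rewrite -(limg_ker_dim (linfun (@wrow w j)) fullv) capfv.
Qed.

Local Notation one := (fun _ : 'I_m => 1 : K).
Let one0 i : one i != 0 := oner_neq0 K.
Local Notation Vdim j := (\dim (wval one j)).

Lemma wval_full j : interpolates a j -> Vdim j = m.
Proof.
move=> Hj; have -> : wval one j = fullv.
  apply/vspaceP=> v; rewrite memvf; apply/wvalP.
  by have [f hf E] := Hj (fun i => v 0 i); exists f => // i; rewrite E mul1r.
by rewrite dimvf /dim /= mul1n.
Qed.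

Lemma perp_wval (e : 'I_m -> K) j u :
  (forall v, v \in wval one j -> \sum_i e i * (u i * v 0 i) = 0) <->
  forall f : R, f \is j.-homog -> \sum_i (e i * u i) * f.@[a i] = 0.
Proof.
split=> [H f hf|H v /wvalP[f hf E]].
  rewrite -[RHS](H (\row_i f.@[a i])).
    by apply: eq_bigr => i _; rewrite mxE mulrA.
  by apply/wvalP; exists f => // i; rewrite mxE mul1r.
by rewrite -[RHS](H f hf); apply: eq_bigr => i _; rewrite E mul1r mulrA.
Qed.

(** By apolarity a functional that vanishes on all values in degree r is a relation
    among the L_i^r. *)
Lemma independent_interpolates r :
  (forall c, \sum_i c i *: dual_form (a i) ^+ r = 0 -> forall i, c i = 0) ->
  interpolates a r.
Proof.
move=> ind; have [W [WP dW]] := perp_dim (wval one r) one0.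
have W0 : W = 0%VS.
  apply/vspaceP=> u; rewrite memv0; apply/idP/eqP => [/WP/perp_wval H|->]; last exact: mem0v.
  apply/rowP=> i; rewrite mxE; apply: (ind (fun i => u 0 i)).
  apply/(sum_pow_eq0 charK0) => f hf; rewrite -[RHS](H f hf).
  by apply: eq_bigr => k _; rewrite mul1r.
move: dW; rewrite W0 dimv0 add0n => dV v.
have : \row_i v i \in wval one r.
  have /eqP -> : wval one r == fullv; last exact: memvf.
  by rewrite eqEdim subvf dimvf /dim /= mul1n dV.
by move=> /wvalP[f hf E]; exists f => // i; have := E i; rewrite mxE mul1r.
Qed.

(** The relations among the L_i^r are the orthogonal space of the values in degree
    r, so a line of relations means codimension one. *)
Lemma relation_wval_dim r (d : 'I_m -> K) : (0 < m)%N -> (forall i, d i != 0) ->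
  \sum_i d i *: dual_form (a i) ^+ r = 0 ->
  (forall d', \sum_i d' i *: dual_form (a i) ^+ r = 0 ->
     exists t, forall i, d' i = t * d i) ->
  (Vdim r).+1 = m.
Proof.
move=> m0 d0 rel uniq; have [W [WP dW]] := perp_dim (wval one r) one0.
have WE : W = <[\row_i d i]>%VS.
  apply/vspaceP=> u; apply/idP/vlineP => [/WP/perp_wval H|[t ->]].
    have [|t E] := uniq (fun i => u 0 i).
      apply/(sum_pow_eq0 charK0) => f hf; rewrite -[RHS](H f hf).
      by apply: eq_bigr => k _; rewrite mul1r.
    by exists t; apply/rowP=> i; rewrite !mxE E.
  apply/WP/perp_wval => f hf.
  have /(sum_pow_eq0 charK0)/(_ f hf) := rel.
  move/(congr1 (fun x => t * x)); rewrite mulr0 mulr_sumr => e; rewrite -[RHS]e.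
  by apply: eq_bigr => i _; rewrite !mxE mul1r mulrA.
move: dW; rewrite WE dim_vline.
have -> : \row_i d i != 0; last by rewrite add1n.
by apply/eqP=> /rowP/(_ (Ordinal m0)); rewrite !mxE; apply/eqP.
Qed.

Context (r : nat) (d : 'I_m -> K).
Hypothesis m_gt0 : (0 < m)%N.
Hypothesis full_r : interpolates a r.
Hypothesis d_ne0 : forall i, d i != 0.
Hypothesis d_rel : \sum_i d i *: pow_pred (dual_form (a i)) r = 0.
Hypothesis d_uniq : forall d', \sum_i d' i *: pow_pred (dual_form (a i)) r = 0 ->
  exists t, forall i, d' i = t * d i.
Hypothesis sym : symmetric_h_vector I.
Context (b : 'I_N -> K).
Local Notation l := (lform b).
Local Notation J := (plus_l I b).
Hypothesis l_ne0 : forall i, l.@[a i] != 0.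
Let HI := vanishing_hideal a.
Let HJ := plus_l_hideal HI b.

Lemma full_above j : (r <= j)%N -> Vdim j = m.
Proof. by move=> rj; apply: wval_full; apply: (interpolates_up l_ne0 full_r). Qed.

(** The Hilbert function in degree [j - 1], with value 0 in degree -1. *)
Definition Vdim_pred j : nat := if j is j'.+1 then Vdim j' else 0%N.

Lemma Vdim_pred_r : (Vdim_pred r).+1 = m.
Proof.
case: r full_r d_rel d_uniq => [|r'] Hr rel uniq /=; last first.
  exact: (relation_wval_dim m_gt0 d_ne0 rel).
(* in degree 0 every tuple is a relation, so there is only one point *)
have [m2|] := ltnP 1 m; last by move=> m1; apply/eqP; rewrite eqn_leq m1 m_gt0.
have [|t E] := uniq (fun i => (i == Ordinal m_gt0)%:R).
  by rewrite big1 // => i _; rewrite scaler0.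
have /eqP := E (Ordinal m2); rewrite eq_sym mulf_eq0 (negbTE (d_ne0 _)) orbF => /eqP t0.
by have /eqP := E (Ordinal m_gt0); rewrite eqxx t0 mul0r oner_eq0.
Qed.

(** Symmetry of h, summed: \sum_(k < j) h_k = \sum_(k > r - j) h_k. The socle
    degree s of h is r because the Hilbert function is m - 1 in degree r - 1 and
    m from degree r on. *)
Lemma Vdim_duality j : (j <= r)%N -> (Vdim_pred j + Vdim (r - j))%N = m.
Proof.
have [H [s [hilb hs habove hsym]]] := sym.
have HE j' : H j' = Vdim j'.
  by have [U [HU dU]] := hilb j'; apply: (hilbert_wval one0 HU dU).
have diffE j' : first_difference H j' = (Vdim j')%:Z - (Vdim_pred j')%:Z.
  by case: j' => [|j'] /=; rewrite !HE ?subr0.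
have predr := Vdim_pred_r; have fullr := full_above (leqnn r).
have sr : s = r.
  apply/eqP; rewrite eqn_leq; apply/andP; split; rewrite leqNgt; apply/negP => lt.
    case/eqP: hs; rewrite diffE (full_above (ltnW lt)).
    case: s lt {habove hsym} => [//|s'] lt; rewrite /= full_above ?subrr //.
  by have := habove _ lt; rewrite diffE; lia.
elim: j => [|j IH] jr; first by rewrite subn0 /= fullr.
have := IH (ltnW jr); have := hsym j; rewrite sr !diffE => /(_ (ltnW jr)).
have -> : Vdim_pred (r - j) = Vdim (r - j.+1) by rewrite -(subnSK jr).
rewrite /=; lia.
Qed.

(** The coefficients for which I + (l) turns out to be Ann(\sum_i e_i L_i^r). *)
Definition dual_weight i := d i / l.@[a i].

Lemma dual_weight_ne0 i : dual_weight i != 0.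
Proof. by rewrite mulf_neq0 ?invr_eq0. Qed.

Lemma dual_weight_J f : f \is r.-homog -> J f -> evalform a dual_weight f = 0.
Proof.
move: f; apply/(evalform_J charK0); rewrite -[RHS]d_rel; apply: eq_bigr => i _.
by rewrite /dual_weight divfK.
Qed.

(** The values of f are orthogonal to those of degree r - k. This orthogonal space
    contains l times the values of degree k - 1, and by [Vdim_duality] the
    dimensions agree; so f has the values of l times a form. *)
Lemma pairing_nondegenerate k f : (k <= r)%N -> f \is k.-homog ->
  (forall g : R, g \is (r - k).-homog -> evalform a dual_weight (f * g) = 0) -> J f.
Proof.
move=> kr hf H.
have [W [WP dW]] := perp_dim (wval one (r - k)) dual_weight_ne0.
have fW : \row_i f.@[a i] \in W.
  apply/WP/perp_wval => g hg; rewrite -[RHS](H g hg).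
  by apply: eq_bigr => i _; rewrite mxE mevalM mulrA.
have := Vdim_duality kr; case: k kr hf H WP dW fW => [|k] kr hf H WP dW fW /= dual.
  have W0 : W = 0%VS by apply/eqP; rewrite -dimv_eq0; lia.
  move: fW; rewrite W0 memv0 => /eqP/rowP f0.
  by apply/plus_lI/(vanishing_homog a hf) => i; have := f0 i; rewrite !mxE.
(* W is the orthogonal space; the inclusion is clear and dimensions agree *)
have WE : wval (fun i => l.@[a i]) k = W.
  apply/eqP; rewrite eqEdim (wval_dim k l_ne0 one0); apply/andP; split; last by lia.
  apply/subvP=> v /wvalP[g hg E]; apply/WP/perp_wval => h hh.
  rewrite -[RHS](@dual_weight_J (l * (g * h))).
  - by apply: eq_bigr => i _; rewrite E !mevalM !mulrA.
  - rewrite (_ : r = (k + (r - k.+1)).+1); last by lia.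
    by apply: mull_homog; apply: dhomogM.
  - exact: (plus_l_mul HI).
move: fW; rewrite -WE => /wvalP[g hg E]; apply/(plus_l_homog a b hf); exists g => // i.
by have := E i; rewrite mxE.
Qed.

Lemma mpoly_homogS_split j (h : R) : h \is j.+1.-homog ->
  exists g : 'I_N -> R, h = \sum_i 'X_i * g i.
Proof.
move=> /euler_mpoly E; exists (fun i => (j.+1%:R^-1 : K) *: h^`M(i)).
have nz : (j.+1)%:R != 0 :> K by apply: natr_neq0.
transitivity ((j.+1%:R^-1 * j.+1%:R : K) *: h); first by rewrite mulVf // scale1r.
rewrite -scalerA -E scaler_sumr.
by apply: eq_bigr => i _; rewrite scalerAr.
Qed.

Lemma dual_weight_kernel f : f \is r.-homog -> evalform a dual_weight f = 0 <-> J f.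
Proof.
move=> hf; split; last exact: dual_weight_J.
move=> e0; apply: (pairing_nondegenerate (leqnn r) hf) => g; rewrite subnn => hg.
have -> : g = (g@_0%MM)%:MP.
  apply/mpolyP=> mon; rewrite mcoeffC; have [->|ne] := eqVneq mon 0%MM; first by rewrite mulr1.
  by rewrite mulr0 (dhomog_nemf_coeff hg) // mdeg_eq0.
by rewrite mulrC evalformZ e0 mulr0.
Qed.

(** A socle element in degree below r is orthogonal to everything of complementary
    degree, because forms of positive degree are combinations of the variables. *)
Lemma gorenstein_of_symmetric : gorenstein_section a b r.
Proof.
have above e f : (r < e)%N -> f \is e.-homog -> J f.
  exact: (plus_l_above l_ne0 full_r).
split=> //.
- have [g hg E] := full_r (fun k => (k == Ordinal m_gt0)%:R); exists g => //.
  move/(dual_weight_J hg)/eqP; apply/negP.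
  rewrite /evalform (bigD1 (Ordinal m_gt0)) //= E eqxx mulr1 big1 ?addr0 => [|k ne].
    exact: dual_weight_ne0.
  by rewrite E (negbTE ne) mulr0.
- move=> k g [hg sg] nJ; apply/eqP; rewrite eqn_leq; apply/andP; split; rewrite leqNgt.
    by apply/negP=> rk; apply: nJ; apply: (above k).
  apply/negP=> kr; apply/nJ/(pairing_nondegenerate (ltnW kr) hg) => h hh.
  apply: dual_weight_J; first by rewrite -(subnKC (ltnW kr)) dhomogM.
  have [h' ->] : exists h' : 'I_N -> R, h = \sum_i 'X_i * h' i.
    by apply: (@mpoly_homogS_split (r - k.+1)); rewrite subnSK.
  rewrite mulr_sumr; elim/big_ind: _ => [||i _]; [exact: (hid0 HJ) | exact: (hidD HJ) |].
  by rewrite mulrCA mulrA [X in J X]mulrC; apply: (hidM HJ); apply: sg.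
- move=> g1 g2 h1 h2 nJ2.
  have e2 : evalform a dual_weight g2 != 0 by apply/eqP => /(dual_weight_kernel h2).
  exists (evalform a dual_weight g1 / evalform a dual_weight g2).
  apply/dual_weight_kernel; first by rewrite mul_mpolyC rpredB // rpredZ.
  by rewrite -mulNr -mpolyCN evalformD evalformZ mulNr divfK ?subrr.
Qed.

End FromSymmetry.

(** * Both directions of the theorem *)

Section Bridge.
Context {K : fieldType} {n : nat}.
Local Notation N := n.+1.
Local Notation R := {mpoly K[N]}.

Lemma linear_formP (l : R) : l \is 1.-homog -> exists b, l = lform b.
Proof.
move=> hl; exists (fun i => l@_U_(i)%MM); apply/mpolyP=> mon.
rewrite /lform raddf_sum /=.
under eq_bigr => i _ do rewrite mcoeffCM mcoeffX.
have [/eqP/mdeg1P[i /eqP ->]|ne] := eqVneq (mdeg mon) 1%N.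
  rewrite (bigD1 i) //= eqxx mulr1 big1 ?addr0 // => j ji.
  rewrite (_ : (U_(j) == U_(i))%MM = false) ?mulr0 //.
  by apply: contraNF ji => /eqP/mnmP/(_ j); rewrite !mnm1E eqxx eq_sym; case: eqP.
rewrite (dhomog_nemf_coeff hl ne) big1 // => i _.
by case: eqP => [e|_]; rewrite ?mulr0 //; move: ne; rewrite -e mdeg1 eqxx.
Qed.

Lemma ideal_addP (I : R -> Prop) b f : hideal I ->
  ideal_add I (lform b) f <-> plus_l I b f.
Proof.
move=> HI; split=> [[k [u [g [Hg ->]]]]|[u [v [Iu ->]]]].
  have HJ := plus_l_hideal HI b.
  elim/big_ind: _ => [||i _]; [exact: (hid0 HJ) | exact: (hidD HJ) |].
  case: (Hg i) => [Ig|->]; first by apply: plus_lI; apply: (hidM HI).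
  by rewrite mulrC; apply: (plus_l_mul HI).
exists 2%N, (fun i => if i == ord0 then 1 else v), (fun i => if i == ord0 then u else lform b).
split; first by move=> i; case: eqP; [left | right].
by rewrite big_ord_recl big_ord1 /= mul1r [v * _]mulrC.
Qed.

Lemma complex_of_resolution (I : R -> Prop) (F : min_graded_free_res I) :
  min_graded_complex I (res_diff F).
Proof.
by case: F => sh df h0 fin gr mi e0 e1; split.
Qed.

Lemma resolution_of_complex (I : R -> Prop) sh df :
  @min_graded_complex K n I sh df -> (forall i, (n < i)%N -> sh i = [::]) ->
  exists F : min_graded_free_res I, res_shifts F = sh.
Proof.
move=> [h0 gr mi e0 e1] nil.
by exists (MinGradedFreeRes h0 (ex_intro _ n nil) gr mi e0 e1).
Qed.

End Bridge.

Section Converse.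
Context {K : fieldType} {n m r : nat}.
Hypothesis charK0 : [pchar K] =i pred0.
Context (a : 'I_m -> 'I_n.+1 -> K).
Local Notation I := (vanishing_ideal a).

Lemma span_dim_independent :
  \dim <<[seq dual_form_pow (a i) r | i : 'I_m]>>%VS = m ->
  forall c, \sum_i c i *: dual_form (a i) ^+ r = 0 -> forall i, c i = 0.
Proof.
move=> dm c c0.
pose X := [tuple dual_form_pow (a i) r | i < m].
have XE : X = [seq dual_form_pow (a i) r | i : 'I_m] :> seq _.
  by rewrite /= /image_mem enumT.
have /freeP fX : free X by rewrite /free XE dm size_map -cardT card_ord.
have Xi (i : 'I_m) : X`_i = dual_form_pow (a i) r by rewrite -tnth_nth tnth_mktuple.
apply: fX; apply: val_inj; rewrite -[RHS]c0 raddf_sum.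
by apply: eq_bigr => i _; rewrite Xi.
Qed.

Lemma pow_pred_relation_linear (s : K) u v :
  \sum_(i < m) u i *: pow_pred (dual_form (a i)) r = 0 ->
  \sum_(i < m) v i *: pow_pred (dual_form (a i)) r = 0 ->
  \sum_(i < m) (u i + s * v i) *: pow_pred (dual_form (a i)) r = 0.
Proof.
move=> u0 v0; under eq_bigr => i _ do rewrite scalerDl -scalerA.
by rewrite big_split /= -scaler_sumr u0 v0 scaler0 addr0.
Qed.

(** The resolution exists for any set of points; that F_n has rank one and twist
    r + n is the statement that the socle of R/(I + (l)) is a line in degree r. *)
Lemma gorenstein_resolution (b : 'I_n.+1 -> K) : (0 < m)%N ->
  (forall i, (lform b).@[a i] != 0) -> gorenstein_section a b r ->
  exists2 F : min_graded_free_res I, res_shifts F n = [:: (r + n)%N] &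
    (forall i, (n < i)%N -> res_shifts F i = [::]) /\
    (forall i t, t \in res_shifts F i -> (t <= r + i)%N).
Proof.
move=> m0 l0 G; have HI := vanishing_hideal a; have nzd := vanishing_nzd l0.
have above := gs_above G.
have [sh [df HF]] := exists_min_graded_complex charK0 HI nzd above
  (fun f => vanishing_proper m0).
have nil i : (n < i)%N -> sh i = [::] by exact: (shift_nil charK0 HI HF nzd).
have [F FE] := resolution_of_complex HF nil.
exists F; rewrite FE; last split=> // i t /(nthP 0%N)[k lt <-].
  have [g hg nJ] := gs_nonzero G; have sg := socle_top above hg.
  have := socle_shift charK0 HI HF nzd sg nJ.
  have : (size (sh n) <= 1)%N.
    apply: (shifts_le1 charK0 HI HF nzd (r := r)).
      by move=> e f se ne; apply: NNPP => /(gs_socle G se).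
    by move=> g1 g2 [h1 _] [h2 _]; apply: (gs_dim1 G).
  by case: (sh n) => [|x [|y s]] // _; rewrite inE => /eqP ->.
exact: (shift_le charK0 HI HF nzd (Ordinal lt) above).
Qed.

Lemma power_in_Ann c (b : 'I_n.+1 -> K) :
  Ann (\sum_i c i *: dual_form (a i) ^+ r) (lform b ^+ r.+1).
Proof.
have hl : lform b ^+ r.+1 \is r.+1.-homog.
  by rewrite -[X in X.-homog]mul1n; apply: dhomogMn; apply: lform_homog.
apply/(Ann_sum_pow charK0) => k g kr _; rewrite big1 // => i _.
rewrite (pihomog_ne0 _ hl) ?meval0 ?mul0r ?mulr0 //.
by rewrite neq_ltn ltnS kr orbT.
Qed.

Lemma Ann_linear_relation c (b : 'I_n.+1 -> K) :
  Ann (\sum_i c i *: dual_form (a i) ^+ r) (lform b) ->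
  \sum_i (c i * (lform b).@[a i]) *: pow_pred (dual_form (a i)) r = 0.
Proof.
move/(Ann_sum_pow charK0); case: r => [_|r' H] /=.
  by rewrite big1 // => i _; rewrite scaler0.
apply/(sum_pow_eq0 charK0) => g hg; rewrite -[RHS](H 1%N g) ?subn1 //.
by apply: eq_bigr => i _; rewrite (pihomog_dE (lform_homog b)) mulrA.
Qed.

(** The power l0^(r+1) annihilates all forms of degree r, but is not in I. *)
Lemma Ann_not_vanishing c (b0 b : 'I_n.+1 -> K) i : (lform b0).@[a i] != 0 ->
  (forall k, (lform b).@[a k] = 0) ->
  ~ (forall f, Ann (\sum_i c i *: dual_form (a i) ^+ r) f <->
               ideal_add I (lform b) f).
Proof.
move=> l0 lb H; have HI := vanishing_hideal a.
have Il : I (lform b) by apply/(vanishing_homog a (lform_homog b)).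
have /H/(ideal_addP b _ HI)[u [v [Iu E]]] := power_in_Ann c b0.
have : I (lform b0 ^+ r.+1).
  by rewrite E; apply: (hidD HI) => //; rewrite mulrC; apply: (hidM HI).
have hl : lform b0 ^+ r.+1 \is r.+1.-homog.
  by rewrite -[X in X.-homog]mul1n; apply: dhomogMn; apply: lform_homog.
move/(vanishing_homog a hl)/(_ i)/eqP; rewrite rmorphXn expf_eq0 /=.
by rewrite (negbTE l0).
Qed.

End Converse.

Theorem theorem2p2 (K : fieldType) (charK0 : [pchar K] =i pred0) (n : nat) :
  (* direct part *)
  (forall (m : nat) (a : 'I_m -> 'I_n.+1 -> K) (r : nat) (l : {mpoly K[n.+1]}),
     (0 < m)%N ->
     nonzero_coords a ->
     distinct_points a ->
     has_regularity (vanishing_ideal a) r ->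
     arith_gorenstein n (vanishing_ideal a) ->
     l \is 1.-homog ->
     (forall i, l.@[a i] != 0) ->
     exists c : 'I_m -> K,
       unique_nonzero_upto_scalar
         (fun c' => \sum_(i < m)
            (c' i * l.@[a i]) *: pow_pred (dual_form (a i)) r = 0) c /\
       (forall f : {mpoly K[n.+1]},
          ideal_add (vanishing_ideal a) l f <->
          Ann (\sum_(i < m) c i *: dual_form (a i) ^+ r) f))
  /\
  (* converse part *)
  (forall (m r : nat) (a : 'I_m -> 'I_n.+1 -> K) (c d : 'I_m -> K),
     let F := \sum_(i < m) c i *: dual_form (a i) ^+ r in
     (0 < m)%N ->
     nonzero_coords a ->
     (forall i, c i != 0) ->
     \dim <<[seq dual_form_pow (a i) r | i : 'I_m]>>%VS = m ->
     unique_nonzero_upto_scalar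
       (fun d' => \sum_(i < m) d' i *: pow_pred (dual_form (a i)) r = 0) d ->
     symmetric_h_vector (vanishing_ideal a) ->
     [/\ arith_gorenstein n (vanishing_ideal a),
         has_regularity (vanishing_ideal a) r &
         forall l : {mpoly K[n.+1]}, l \is 1.-homog ->
           (forall f : {mpoly K[n.+1]},
              Ann F f <-> ideal_add (vanishing_ideal a) l f) <->
           (exists2 t : K, t != 0 & forall i, l.@[a i] = t * d i / c i)]).
Proof.
split.
  move=> m a r _ m0 nz dist [F' [reg reg0]] [F [alpha [Fn _]]] /linear_formP[b ->] l0.
  have full : exists j, interpolates a j by exists m; apply: distinct_interpolates.
  have sz : size (res_shifts F n) = 1%N by rewrite Fn.
  have G := gorenstein_of_resolutions charK0 l0 m0 full (complex_of_resolution F) sz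
    (complex_of_resolution F') reg reg0.
  have [c [uc HA]] := gorenstein_unique_relation charK0 l0 G m0 full.
  by exists c; split=> // f; rewrite (ideal_addP b f (vanishing_hideal a)).
move=> m r a c d F m0 nz c0 dm ud sym.
have HI := vanishing_hideal a; have [d0 drel _] := ud.
have full := independent_interpolates charK0 (span_dim_independent dm).
have lin := @pow_pred_relation_linear K n m r a.
have uniq d' := @proportional_of_unique K charK0 m _ d d' lin ud.
have Gor b := gorenstein_of_symmetric charK0 m0 full d0 drel uniq sym (b := b).
have [b0 l0] := generic_linear_form charK0 nz.
have [FF FFn [FFnil FFreg]] := gorenstein_resolution charK0 m0 l0 (Gor b0 l0).
split.
- by exists FF, (r + n)%N.
- exists FF; split=> //; exists n; rewrite FFn; exact: mem_head.
move=> _ /linear_formP[b ->]; split=> [H|[t t0 E]].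
  have Annl : Ann F (lform b).
    by apply/H/ideal_addP => //; rewrite -[lform b]mulr1; apply: (plus_l_mul HI).
  have [|t E] := uniq (fun i => c i * (lform b).@[a i]).
    exact: Ann_linear_relation.
  have E' i : (lform b).@[a i] = t * d i / c i by rewrite -E mulrAC mulfV ?mul1r.
  exists t => //; apply/eqP => t0.
  apply: (Ann_not_vanishing charK0 (l0 (Ordinal m0)) _ H) => k.
  by rewrite E' t0 !mul0r.
have lb i : (lform b).@[a i] != 0 by rewrite E !mulf_neq0 ?invr_eq0.
move=> f; rewrite (ideal_addP b f HI).
apply: (Ann_of_evalform charK0 f (Gor b lb)) => g hg.
rewrite -(dual_weight_kernel charK0 m0 full d0 drel uniq sym lb hg).
have cE i : c i = t * dual_weight a d b i.
  by rewrite /dual_weight E; field; rewrite c0 t0 d0.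
have -> : evalform a c g = t * evalform a (dual_weight a d b) g.
  by rewrite -evalform_scale; apply: eq_bigr => i _; rewrite -cE.
by split=> [/eqP|->]; rewrite ?mulr0 // mulf_eq0 (negbTE t0) => /eqP.
Qed.
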